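(* For every $1/2\leqslant\sigma\leqslant1$ there exist $c>0$, a planar convex body $C_{\sigma}$, and finite sets $\mathcal{P}_{N_{j}}\subset\mathbb{T}^{2}$ ($j=1,2,\dots$) of cardinality $N_{j}\rightarrow+\infty$ with the following two properties. (i) There exist constants $\delta_0,c_1,c_2>0$ and an interval $I$ of positive length in $(-\pi,\pi)$ such that for every $0<\delta\leqslant\delta_{0}$, with $\Theta=(\cos\theta,\sin\theta)$ and chords taken with respect to $C_\sigma$, $$\left\vert \gamma_{-\Theta}(\delta)\right\vert +\left\vert \gamma_{\Theta}(\delta)\right\vert \geqslant c_{1}\delta^{1/2}\quad\text{for every }\theta\in I,$$ $$\left\vert \gamma_{-\Theta}(\delta)\right\vert +\left\vert \gamma_{\Theta}(\delta)\right\vert \geqslant c_{2}\delta^{\sigma}\quad\text{for every }\theta\in(-\pi,\pi)\setminus I.$$ (ii) For every $j$, $$\int_{0}^{1}\int_{\mathbb{T}^{2}}\left\vert \mathrm{card}\left(\mathcal{P}_{N_{j}}\cap\left(\lambda C_{\sigma}+t\right)\right)-\lambda^{2}N_{j}\left\vert C_{\sigma}\right\vert \right\vert ^{2}\,dt\,d\lambda\leqslant cN_{j}^{2/(2\sigma+3)}.$$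
   Context: $\mathbb{T}^{2}=\mathbb{R}^{2}/\mathbb{Z}^{2}$. A planar convex body is a bounded convex subset of $\mathbb{R}^2$ with non-empty interior, and $|C|$ is its area. For a finite set $\mathcal{P}_N=\{u_1,\dots,u_N\}\subset\mathbb{T}^2$, a planar convex body $C$, $\lambda>0$ and $t\in\mathbb{T}^2$, $\mathrm{card}(\mathcal{P}_N\cap(\lambda C+t))$ denotes $\sum_{j=1}^N\sum_{k\in\mathbb{Z}^2}\chi_{\lambda C}(u_j-t+k)$, where $\chi_{\lambda C}$ is the characteristic function of $\lambda C\subset\mathbb{R}^2$; this is the ordinary number of points of $\mathcal{P}_N$ in the translated set $\lambda C+t$ whenever $\lambda C$ projects injectively to $\mathbb{T}^2$. For a unit vector $\Theta$ and $\delta>0$, the chord of $C$ is $$\gamma_{\Theta}(\delta)=\left\{x\in C: x\cdot\Theta=\inf_{y\in C}(y\cdot\Theta)+\delta\right\}$$ and $|\gamma_\Theta(\delta)|$ is its length. *)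

(* Defs.v *)
From HB Require Import structures.
From mathcomp Require Import all_boot all_order all_algebra finmap.
From mathcomp Require Import all_classical all_reals all_analysis.

Set Implicit Arguments.
Unset Strict Implicit.
Unset Printing Implicit Defensive.

Import Order.TTheory GRing.Theory Num.Theory.
Import numFieldNormedType.Exports.

Local Open Scope classical_set_scope.
Local Open Scope ring_scope.

Definition planar_convex_body (R : realType) (C : set (R * R)) : Prop :=
  [/\ bounded_set C, convex_set C & C° !=set0].

Definition area {R : realType} : set (R * R) -> \bar R :=
  (lebesgue_measure \x lebesgue_measure)%E.

(* The torus R^2/Z^2 is represented by its fundamental domain [0,1)^2. *)
Definition torus (R : realType) : set (R * R) :=
  `[0, 1[%classic `*` `[0, 1[%classic.
Arguments torus : clear implicits.

Definition dilate (R : realType) (l : R) (C : set (R * R)) : set (R * R) :=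
  [set l *: x | x in C].

(* The points of P falling in the projection of A + t to the torus, counted
   with multiplicity when that projection is not injective. *)
Definition card_translate (R : realType) (P : {fset R * R}) (A : set (R * R))
    (t : R * R) : \bar R :=
  (\sum_(u <- P)
     \esum_(k in [set: int * int])
       (\1_A (u - t + (k.1%:~R, k.2%:~R)))%:E)%E.

Definition dot (R : realType) (x y : R * R) : R := x.1 * y.1 + x.2 * y.2.

Definition dir (R : realType) (theta : R) : R * R := (cos theta, sin theta).

Definition chord (R : realType) (C : set (R * R)) (Theta : R * R) (delta : R) :
    set (R * R) :=
  [set x | C x /\ dot x Theta = inf [set dot y Theta | y in C] + delta].

(* For a unit vector Theta, x |-> dot x (- Theta.2, Theta.1) is an isometry from
   any line orthogonal to Theta onto R, hence gives arc length on the chord. *)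
Definition chord_length (R : realType) (C : set (R * R)) (Theta : R * R)
    (delta : R) : \bar R :=
  lebesgue_measure
    [set dot x (- Theta.2, Theta.1) | x in chord C Theta delta].

(* Main.v *)
Require Import Defs.
From HB Require Import structures.
From mathcomp Require Import all_boot all_order all_algebra finmap.
From mathcomp Require Import all_classical all_reals all_analysis.
From mathcomp Require Import zify ring lra.

Set Implicit Arguments.
Unset Strict Implicit.
Unset Printing Implicit Defensive.

Import Order.TTheory GRing.Theory Num.Theory.
Import numFieldNormedType.Exports.

Local Open Scope classical_set_scope.
Local Open Scope ring_scope.

(** The body is the Lame oval x ^ 2 + |y| ^ p <= 1 with p = 1 / sigma in [1, 2].
    Its vertical section at x is the segment |y| <= (1 - x ^ 2) ^ sigma. It is
    smoothly curved near (0, 1) and (0, -1), while near (1, 0) and (-1, 0) it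
    looks like |y| ^ p, that is, it is more pointed than a circle, up to a corner
    when sigma = 1.

    Chords. Let z be a supporting point in the direction Theta, let T be the
    tangent direction and F (x, y) = x ^ 2 + |y| ^ p. Both F (z + r T) and
    F (z - r T) are at least 1 because the supporting line avoids the interior,
    and their sum is at most 2 + 2 (r ^ 2 + r ^ p) by Clarkson's inequality for
    p <= 2. So both are close to 1, and a homothety of ratio 1 - O(delta) brings
    z + r T and z - r T into the body, on the line at depth delta, provided that
    r ^ p is a small multiple of delta: the chord has length at least
    c delta ^ sigma in every direction (lame_chord_sigma). When z stays away from
    the horizontal axis, |y| ^ p is twice differentiable at z and r ^ p may be
    replaced by r ^ 2; this covers an interval of directions around the vertical
    one, where the chord has length at least c delta ^ (1/2)
    (lame_chord_curved).

    Discrepancy. Take B equally spaced columns, each containing A equally spaced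
    points, where A is of order B ^ (sigma + 1/2), and shift the points of column
    b vertically by xi_b / (A B) with an integer 0 <= xi_b < B. For fixed lambda
    and t the discrepancy is the sum of two errors.
    - The areas of the columns form a Riemann sum of the section length. Since
      (1 - x ^ 2) ^ sigma is concave on [-1, 1] and is O(h ^ sigma) at distance h
      from the end points, linear interpolation shows that two Riemann sums of
      mesh h differ by O(h ^ (1 + sigma)) (profile_riemann_sum). The resulting
      error is O(A B ^ (- sigma)) = O(B ^ (1/2)).
    - Inside a column, the number of points differs from its expected value by
      O(1), and the average of this difference over the B values of the shift is
      O(1 / B), because the B shifted columns together form one finer column. If
      the shifts are chosen independently and uniformly, the errors of different
      columns are thus nearly uncorrelated, and their sum has second moment O(B)
      (second_moment_shifts).
    So the square of the discrepancy, averaged over all choices of shifts, is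
    O(B) for every lambda and t (discrepancy_average). Integrating over lambda
    and t, some choice of shifts has mean square discrepancy O(B) (good_shifts).
    The interchange of the average with the integral only uses that the integral
    of a nonnegative function is the supremum of the integrals of the simple
    functions below it, hence superadditive on arbitrary functions. Finally
    N = A B is at least B ^ (sigma + 3/2), that is, B <= N ^ (2/(2 sigma + 3)). *)

(** * Powers with exponent at most one, or at most two *)

(** Convexity of the inverse power, applied at a ^ s and b ^ s. *)
Lemma powR_concave (R : realType) (s t a b : R) :
  0 < s <= 1 -> 0 <= t <= 1 -> 0 <= a -> 0 <= b ->
  t * a `^ s + (1 - t) * b `^ s <= (t * a + (1 - t) * b) `^ s.
Proof.
move=> /andP[s0 s1] /andP[t0 t1] a0 b0.
have p1 : 1 <= s^-1 by rewrite invf_ge1.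
have c0 : 0 <= t * a `^ s + (1 - t) * b `^ s.
  by rewrite addr_ge0// mulr_ge0 ?powR_ge0// subr_ge0.
have := @convex_powR R s^-1 p1 (Itv01 t0 t1) (a `^ s) (b `^ s).
rewrite !inE /= !in_itv /= !andbT !powR_ge0 => /(_ isT isT).
rewrite !convRE /= /unstable.onem -!powRrM mulfV ?gt_eqF// !powRr1// => h.
have := ge0_ler_powR (ltW s0) _ _ h; rewrite !nnegrE powR_ge0.
rewrite -powRrM mulVf ?gt_eqF// powRr1//; apply => //.
by rewrite addr_ge0// mulr_ge0// subr_ge0.
Qed.

(** On [0, 1] the power lies above the identity: apply this to a / (a + b) and
    b / (a + b), which add up to 1. *)
Lemma powR_subadditive (R : realType) (s a b : R) :
  0 < s <= 1 -> 0 <= a -> 0 <= b -> (a + b) `^ s <= a `^ s + b `^ s.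
Proof.
move=> /andP[s0 s1] a0 b0.
have [ab0|ab0] := eqVneq (a + b) 0.
  by rewrite ab0 powR0 ?gt_eqF// addr_ge0 ?powR_ge0.
have {}ab0 : 0 < a + b by rewrite lt_neqAle eq_sym ab0 addr_ge0.
have key c : 0 <= c <= a + b -> c / (a + b) * (a + b) `^ s <= c `^ s.
  move=> /andP[c0 cab]; have [->|cN0] := eqVneq c 0.
    by rewrite mul0r mul0r powR_ge0.
  have {2}-> : c = c / (a + b) * (a + b) by rewrite divfK ?gt_eqF.
  have d0 : 0 < c / (a + b) by rewrite divr_gt0// lt_neqAle eq_sym cN0.
  rewrite (powRM _ (ltW d0) (ltW ab0)) ler_wpM2r ?powR_ge0// ger1_powR//.
  by rewrite d0/= ler_pdivrMr// mul1r.
have := lerD (key a _) (key b _).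
rewrite a0 b0 lerDl lerDr a0 b0 => /(_ isT isT); apply: le_trans.
by rewrite -mulrDl -mulrDl mulfV ?gt_eqF// mul1r.
Qed.

(** Subadditivity makes the power Hoelder continuous, including at 0 where it is
    not differentiable. *)
Lemma continuous_powR_max (R : realType) (s : R) : 0 < s <= 1 ->
  continuous (fun u : R => Num.max 0 u `^ s).
Proof.
move=> s01; have /andP[s0 s1] := s01.
have hol (a b : R) : Num.max 0 a `^ s <= Num.max 0 b `^ s + `|b - a| `^ s.
  apply: (@le_trans _ _ ((Num.max 0 b + `|b - a|) `^ s)); last first.
    by apply: powR_subadditive => //; rewrite le_max lexx.
  apply: ge0_ler_powR; rewrite ?nnegrE ?(ltW s0)//.
  - by rewrite le_max lexx.
  - by rewrite addr_ge0// le_max lexx.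
  rewrite ge_max; apply/andP; split; first by rewrite addr_ge0// le_max lexx.
  rewrite -lerBlDr (le_trans _ (_ : b <= _))// ?le_max ?lexx ?orbT//.
  by rewrite lerBlDr -lerBlDl distrC ler_norm.
move=> u; apply/cvgrPdist_le => e e0.
near=> v.
have uv : `|u - v| `^ s <= e.
  rewrite -[leRHS](@powRr1 _ e) ?(ltW e0)//.
  rewrite -[X in e `^ X](@mulVf _ s) ?gt_eqF//.
  rewrite powRrM; apply: ge0_ler_powR; rewrite ?nnegrE ?powR_ge0 ?(ltW s0)//.
  near: v; apply: cvgr_dist_le => //; exact: powR_gt0.
have := hol u v; have := hol v u; rewrite (distrC v u) ler_norml => h1 h2.
by apply/andP; split; lra.
Unshelve. all: by end_near. Qed.

Lemma powR_normE (R : realType) (x p : R) : `|x| `^ p = (x ^+ 2) `^ (p / 2).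
Proof.
rewrite -[x ^+ 2]ger0_norm ?sqr_ge0// normrX -powR_mulrn// -powRrM.
by congr (_ `^ _); lra.
Qed.

(** Concavity of u |-> u ^ (p / 2) at the two squares, whose mean is given by
    the parallelogram law. *)
Lemma powR_parallelogram (R : realType) (p y v : R) : 0 < p <= 2 ->
  `|y + v| `^ p + `|y - v| `^ p <= 2 * (y ^+ 2 + v ^+ 2) `^ (p / 2).
Proof.
move=> /andP[p0 p2].
have q01 : 0 < p / 2 <= 1 by lra.
have h12 : (0 : R) <= (2^-1 : R) <= 1 by rewrite invr_ge0 invf_le1 ?ler0n ?ler1n.
have := @powR_concave R _ _ ((y + v) ^+ 2) ((y - v) ^+ 2) q01 h12
  (sqr_ge0 _) (sqr_ge0 _).
have -> : 2^-1 * (y + v) ^+ 2 + (1 - 2^-1) * (y - v) ^+ 2 = y ^+ 2 + v ^+ 2.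
  by field.
by rewrite !powR_normE; lra.
Qed.

(** Subadditivity of u |-> u ^ (p / 2) in powR_parallelogram. *)
Lemma powR_clarkson (R : realType) (p y v : R) : 0 < p <= 2 ->
  `|y + v| `^ p + `|y - v| `^ p <= 2 * (`|y| `^ p + `|v| `^ p).
Proof.
move=> p02; apply: (le_trans (@powR_parallelogram R _ _ _ p02)).
rewrite ler_pM2l// !powR_normE powR_subadditive ?sqr_ge0//.
by lra.
Qed.

(** Away from y = 0 the second difference of |y| ^ p is quadratic: there
    (y ^ 2 + v ^ 2) ^ (p / 2) is y ^ p times at most 1 + v ^ 2 / y ^ 2. *)
Lemma powR_smooth (R : realType) (p y v : R) : 0 < p <= 2 ->
  2^-1 <= `|y| <= 1 ->
  `|y + v| `^ p + `|y - v| `^ p <= 2 * `|y| `^ p + 8 * v ^+ 2.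
Proof.
move=> p02 /andP[y2 y1]; apply: (le_trans (@powR_parallelogram R _ _ _ p02)).
have yy : 4^-1 <= y ^+ 2.
  by rewrite -[y ^+ 2]ger0_norm ?sqr_ge0// normrX; nra.
have yy1 : y ^+ 2 <= 1.
  by rewrite -[y ^+ 2]ger0_norm ?sqr_ge0// normrX; nra.
have y0 : y ^+ 2 != 0 by apply/eqP => y0; move: yy; rewrite y0; lra.
have -> : y ^+ 2 + v ^+ 2 = y ^+ 2 * (1 + v ^+ 2 / y ^+ 2).
  by rewrite mulrDr mulr1 mulrCA mulfV// mulr1.
have r0 : 0 <= v ^+ 2 / y ^+ 2 by rewrite divr_ge0 ?sqr_ge0.
have r4 : v ^+ 2 / y ^+ 2 <= 4 * v ^+ 2.
  rewrite ler_pdivrMr; last by lra.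
  by have := sqr_ge0 v; nra.
rewrite powRM ?sqr_ge0//; last by lra.
rewrite powR_normE; set A := (y ^+ 2) `^ _.
have A0 : 0 <= A by apply: powR_ge0.
have A1 : A <= 1.
  have := @ge0_ler_powR R (p / 2) _ _ _ _ _ yy1; rewrite powR1; apply.
  - by move: p02 => /andP[]; lra.
  - by rewrite nnegrE sqr_ge0.
  - by rewrite nnegrE.
have B : (1 + v ^+ 2 / y ^+ 2) `^ (p / 2) <= 1 + v ^+ 2 / y ^+ 2.
  by apply: ler1_powR; [lra|move: p02 => /andP[]; lra].
have : A * (1 + v ^+ 2 / y ^+ 2) `^ (p / 2) <= A + v ^+ 2 / y ^+ 2.
  apply: (le_trans (ler_wpM2l A0 B)); rewrite mulrDr mulr1 lerD2l.
  by apply: ler_piMl.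
lra.
Qed.

(** * The Lame oval *)

Definition lame_gauge (R : realType) (s : R) (z : R * R) : R :=
  z.1 ^+ 2 + `|z.2| `^ s^-1.

Definition lame (R : realType) (s : R) : set (R * R) :=
  [set z | lame_gauge s z <= 1].

(** Half the length of the vertical section of the oval at x. The maximum with 0
    makes it vanish outside [-1, 1], since powR is not 0 at negative numbers. *)
Definition profile (R : realType) (s x : R) : R := Num.max 0 (1 - x ^+ 2) `^ s.

Lemma profile_ge0 (R : realType) (s x : R) : 0 <= profile s x.
Proof. exact: powR_ge0. Qed.

Lemma profile_out (R : realType) (s x : R) : 0 < s -> x <= -1 \/ 1 <= x ->
  profile s x = 0.
Proof.
move=> s0 x1; rewrite /profile (max_idPl _) ?powR0 ?gt_eqF//.
by case: x1 => x1; nra.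
Qed.

Lemma profile_le1 (R : realType) (s x : R) : 0 < s -> profile s x <= 1.
Proof.
move=> s0; have <- : 1 `^ s = 1 :> R by rewrite powR1.
rewrite /profile; apply: ge0_ler_powR; rewrite ?nnegrE ?(ltW s0) ?le_max ?lexx//.
by rewrite ge_max ler01/=; have := sqr_ge0 x; lra.
Qed.

Lemma profile_continuous (R : realType) (s : R) : 1 / 2 <= s <= 1 ->
  continuous (profile s).
Proof.
move=> s12 x.
apply: (@cvg_comp _ _ _ (fun x : R => 1 - x ^+ 2) (fun u => Num.max 0 u `^ s)).
  by apply: cvgB; [exact: cvg_cst|exact: exprn_continuous].
by apply: continuous_powR_max; lra.
Qed.

Lemma lame_gauge_convex (R : realType) (s t : R) (z w : R * R) :
  1 / 2 <= s <= 1 -> 0 <= t <= 1 ->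
  lame_gauge s (t *: z + (1 - t) *: w) <=
  t * lame_gauge s z + (1 - t) * lame_gauge s w.
Proof.
move=> s12 /andP[t0 t1]; have s0 : 0 < s by lra.
have p1 : 1 <= s^-1 by rewrite invf_ge1//; lra.
rewrite /lame_gauge /=.
have h1 : (t * z.1 + (1 - t) * w.1) ^+ 2 <= t * z.1 ^+ 2 + (1 - t) * w.1 ^+ 2.
  have := sqr_ge0 (z.1 - w.1); have : 0 <= t * (1 - t) by nra.
  nra.
have h2 : `|t * z.2 + (1 - t) * w.2| `^ s^-1 <=
   t * `|z.2| `^ s^-1 + (1 - t) * `|w.2| `^ s^-1.
  apply: (@le_trans _ _ ((t * `|z.2| + (1 - t) * `|w.2|) `^ s^-1)).
    apply: ge0_ler_powR; rewrite ?nnegrE//.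
    - by lra.
    - by rewrite addr_ge0// mulr_ge0//; lra.
    - rewrite (le_trans (ler_normD _ _))// !normrM (ger0_norm t0).
      by rewrite (@ger0_norm _ (1 - t))//; lra.
  have := @convex_powR R s^-1 p1 (Itv01 t0 t1) `|z.2| `|w.2|.
  rewrite !inE /= !in_itv /= !andbT !normr_ge0 => /(_ isT isT).
  by rewrite !convRE.
by rewrite /GRing.scale /= !mulrDr; lra.
Qed.

Lemma lame_gaugeN (R : realType) (s : R) (z : R * R) :
  lame_gauge s (- z) = lame_gauge s z.
Proof. by rewrite /lame_gauge /= sqrrN normrN. Qed.

Lemma lame_gauge0 (R : realType) (s : R) : 1 / 2 <= s <= 1 ->
  lame_gauge s 0 = 0.
Proof.
move=> s12; rewrite /lame_gauge /= expr0n /= normr0 powR0 ?addr0//.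
by rewrite invr_eq0; apply/eqP; lra.
Qed.

Lemma lame_gaugeZ (R : realType) (s t : R) (z : R * R) :
  1 / 2 <= s <= 1 -> 0 <= t <= 1 ->
  lame_gauge s (t *: z) <= t * lame_gauge s z.
Proof.
move=> s12 t01; have := @lame_gauge_convex R s t z 0 s12 t01.
by rewrite scaler0 addr0 lame_gauge0// mulr0 addr0.
Qed.

Lemma lame_sectionE (R : realType) (s : R) (z : R * R) : 1 / 2 <= s <= 1 ->
  lame s z <-> `|z.1| <= 1 /\ `|z.2| <= profile s z.1.
Proof.
move=> s12; have s0 : 0 < s by lra.
have sN0 : s != 0 by rewrite gt_eqF.
have p0 : 0 < s^-1 by rewrite invr_gt0.
rewrite /lame /lame_gauge /profile /=.
have y0 := powR_ge0 `|z.2| s^-1.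
split=> [h|[h1 h2]].
  have x1 : z.1 ^+ 2 <= 1 by have := sqr_ge0 z.1; lra.
  split.
    by rewrite -(@ler_pXn2r _ 2) ?nnegrE// real_normK ?num_real// expr1n.
  rewrite (max_idPr _); last by lra.
  rewrite -[leLHS]powRr1// -[X in _ `^ X](mulVf sN0) powRrM.
  by apply: ge0_ler_powR; rewrite ?nnegrE; lra.
have x1 : z.1 ^+ 2 <= 1.
  by rewrite -real_normK ?num_real//; have := normr_ge0 z.1; nra.
move: h2; rewrite (max_idPr _); last by lra.
move=> h2; have := @ge0_ler_powR R s^-1 (ltW p0) _ _ _ _ h2.
rewrite !nnegrE normr_ge0 powR_ge0 => /(_ isT isT).
by rewrite -powRrM mulfV// powRr1; lra.
Qed.

Lemma convex_comb_le1 (R : realType) (t a b : R) :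
  0 <= t <= 1 -> a <= 1 -> b <= 1 -> t * a + (1 - t) * b <= 1.
Proof.
move=> /andP[t0 t1] a1 b1.
have : 0 <= t * (1 - a) by rewrite mulr_ge0//; lra.
have : 0 <= (1 - t) * (1 - b) by rewrite mulr_ge0//; lra.
lra.
Qed.

Lemma lame_convex_body (R : realType) (s : R) : 1 / 2 <= s <= 1 ->
  planar_convex_body (lame s).
Proof.
move=> s12; split.
- exists 1; split => // M M1 z /= /(lame_sectionE _ s12)[x1 y1].
  have s0 : 0 < s by lra.
  have f1 := profile_le1 z.1 s0.
  by rewrite prod_normE ge_max; apply/andP; split; lra.
- apply/convex_setW => z w; rewrite !inE /lame /= => hz hw k k0 k1.
  have k01 : 0 <= k%:num <= 1 by rewrite !ltW.
  apply/mem_set => /=.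
  change (is_true (lame_gauge s
    (k%:num *: (z : R * R) + (1 - k%:num) *: (w : R * R)) <= 1)).
  apply: (le_trans (@lame_gauge_convex R s k%:num z w s12 k01)).
  exact: convex_comb_le1.
- exists 0; rewrite /interior /=; apply/nbhs_ballP; exists (1 / 2) => //=.
  move=> z [/=]; rewrite -!ball_normE /= !sub0r !normrN => z1 z2.
  rewrite /lame /= /lame_gauge.
  have : z.1 ^+ 2 <= 1 / 2.
    by rewrite -real_normK ?num_real//; have := normr_ge0 z.1; nra.
  suff : `|z.2| `^ s^-1 <= 1 / 2 by lra.
  apply: le_trans (ltW z2).
  have [->|/eqP z0] := eqVneq `|z.2| 0.
    by rewrite powR0 ?lexx// invr_eq0; apply/eqP; lra.
  apply: ge1r_powR; last by rewrite invf_ge1; lra.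
  by have := normr_ge0 z.2; rewrite le_eqVlt => /predU1P[/esym//|->/=]; lra.
Qed.

(** * Chords of the Lame oval *)

Lemma dotDl (R : realType) (x y w : R * R) : dot (x + y) w = dot x w + dot y w.
Proof. by rewrite /dot /=; ring. Qed.

Lemma dotZl (R : realType) (a : R) (x w : R * R) : dot (a *: x) w = a * dot x w.
Proof. by rewrite /dot /= /GRing.scale /=; ring. Qed.

Lemma dotNl (R : realType) (x w : R * R) : dot (- x) w = - dot x w.
Proof. by rewrite /dot /=; ring. Qed.

Lemma lame_support_exists (R : realType) (s : R) (Theta : R * R) :
  1 / 2 <= s <= 1 ->
  exists2 z, lame s z & forall w, lame s w -> dot w Theta <= dot z Theta.
Proof.
move=> s12; pose f x := x * Theta.1 + profile s x * `|Theta.2|.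
(* For a fixed first coordinate x, the best second coordinate has the sign of
   Theta.2 and modulus profile s x. *)
have cf : {within `[-1, 1], continuous f}.
  apply: continuous_subspaceT => x; apply: cvgD; apply: cvgMr_tmp => //.
  exact: profile_continuous.
have N11 : (-1 : R) <= 1 by lra.
have [c c11 cmax] := EVT_max N11 cf.
have f0 : 0 <= profile s c by exact: powR_ge0.
exists (c, Num.sg Theta.2 * profile s c).
  apply/lame_sectionE => //=; split.
    by rewrite ler_norml; move: c11; rewrite in_itv.
  rewrite normrM (ger0_norm f0) ler_piMl// normr_sg.
  by case: (_ != 0).
move=> w /(lame_sectionE _ s12)[w1 w2].
have := cmax w.1; rewrite in_itv /= -ler_norml => /(_ w1) h.
apply: (@le_trans _ _ (f w.1)).
  rewrite /dot /f lerD2l (le_trans (ler_norm _))// normrM ler_wpM2r//.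
apply: (le_trans h); rewrite /f /dot /= normrEsg.
by rewrite mulrCA mulrA.
Qed.

Lemma lame_axis_points (R : realType) (s : R) : 1 / 2 <= s <= 1 ->
  lame s (1, 0) /\ lame s (0, 1).
Proof.
move=> s12; rewrite /lame /lame_gauge /=; split.
  rewrite normr0 powR0; first by rewrite expr1n addr0.
  by rewrite invr_eq0; apply/eqP; lra.
by rewrite normr1 powR1 expr0n /= add0r.
Qed.

Lemma lame_support_value (R : realType) (s : R) (Theta z : R * R) :
  1 / 2 <= s <= 1 -> Theta.1 ^+ 2 + Theta.2 ^+ 2 = 1 -> lame s z ->
  (forall u, lame s u -> dot u Theta <= dot z Theta) ->
  1 / 2 <= dot z Theta <= 2.
Proof.
move=> s12 unit Cz zmax; have s0 : 0 < s by lra.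
have [C10 C01] := lame_axis_points s12.
have CN (u : R * R) : lame s u -> lame s (- u) by rewrite /lame /= lame_gaugeN.
have := zmax _ C10; have := zmax _ (CN _ C10).
have := zmax _ C01; have := zmax _ (CN _ C01).
rewrite /dot /= !mulN1r !mul1r !mul0r !oppr0 !mul0r !addr0 !add0r.
move=> h1 h2 h3 h4; apply/andP; split.
  rewrite leNgt; apply/negP => hlt; set H := _ + _ in h1 h2 h3 h4 hlt.
  have q1 : 0 <= (1 / 2 - Theta.1) * (1 / 2 + Theta.1) by rewrite mulr_ge0//; lra.
  have q2 : 0 <= (1 / 2 - Theta.2) * (1 / 2 + Theta.2) by rewrite mulr_ge0//; lra.
  by move: unit; nra.
have [z1 z2] := (lame_sectionE z s12).1 Cz.
have sq1 (x : R) : `|x| <= 1 -> x ^+ 2 <= 1.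
  by move=> x1; rewrite -real_normK ?num_real//; have := normr_ge0 x; nra.
have := sq1 _ z1; have := sq1 _ (le_trans z2 (profile_le1 _ s0)).
have := sqr_ge0 (z.1 - Theta.1); have := sqr_ge0 (z.2 - Theta.2).
by move: unit; rewrite !expr2; lra.
Qed.

(** Otherwise w would be interior to the oval, and a multiple (1 + t) *: w
    would still lie in the oval, beyond the supporting line. *)
Lemma gauge_ge1_on_support_line (R : realType) (s : R) (Theta z w : R * R) :
  1 / 2 <= s <= 1 -> 0 < dot z Theta ->
  (forall u, lame s u -> dot u Theta <= dot z Theta) ->
  dot w Theta = dot z Theta -> 1 <= lame_gauge s w.
Proof.
move=> s12 H0 zmax wz; rewrite leNgt; apply/negP => w1.
set g := lame_gauge s w in w1; set g2 := lame_gauge s (2 *: w).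
have g20 : 0 <= g2 by rewrite addr_ge0 ?sqr_ge0 ?powR_ge0.
have g0 : 0 <= g by rewrite addr_ge0 ?sqr_ge0 ?powR_ge0.
(* The weight t solves t * (1 + g2) = 1 - g, so that the combination of 2 *: w
   and w below has gauge at most g + t * g2 <= 1. *)
pose t := (1 - g) / (1 + g2).
have t0 : 0 < t by rewrite divr_gt0//; lra.
have t1 : t <= 1 by rewrite ler_pdivrMr; lra.
have tg : t * (1 + g2) = 1 - g by rewrite divfK// gt_eqF//; lra.
have t01 : 0 <= t <= 1 by rewrite t1 ltW.
have := @lame_gauge_convex R s t (2 *: w) w s12 t01.
have -> : t *: (2 *: w) + (1 - t) *: w = (1 + t) *: w.
  by rewrite scalerA -scalerDl; congr (_ *: _); ring.
rewrite -/g -/g2 => h.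
have : lame s ((1 + t) *: w).
  have tg0 : 0 <= t * g by rewrite mulr_ge0// ltW.
  by apply: (le_trans h); lra.
by move=> /zmax; rewrite dotZl wz; nra.
Qed.

Lemma inf_dot_symmetric (R : realType) (C : set (R * R)) (Theta z : R * R) :
  (forall u, C u -> C (- u)) -> C z ->
  (forall u, C u -> dot u Theta <= dot z Theta) ->
  inf [set dot y Theta | y in C] = - dot z Theta.
Proof.
move=> CN Cz zmax; apply/eqP; rewrite eq_le; apply/andP; split.
  apply: ge_inf; last by exists (- z); [exact: CN|rewrite dotNl].
  exists (- dot z Theta) => _ [u Cu <-].
  by rewrite lerNl -dotNl; exact/zmax/CN.
apply: lb_le_inf; first by exists (dot z Theta), z.
by move=> _ [u Cu <-]; rewrite lerNl -dotNl; exact/zmax/CN.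
Qed.

Lemma convex_set_segment (R : realType) (C : set (R * R)) :
  convex_set C -> forall (z w : R * R) (t : R), 0 <= t <= 1 -> C z -> C w ->
  C (t *: z + (1 - t) *: w).
Proof.
move=> CC z w t /andP[t0 t1] Cz Cw.
exact: set_mem (CC z w (Itv01 t0 t1) (mem_set Cz) (mem_set Cw)).
Qed.

(** The chord is convex, so its coordinates along the line form an interval; this
    gives measurability as well as the inclusion of the segment from p to q. *)
Lemma chord_length_ge (R : realType) (C : set (R * R)) (Theta p q : R * R)
    (delta : R) : convex_set C ->
  chord C Theta delta p -> chord C Theta delta q ->
  ((dot q (- Theta.2, Theta.1) - dot p (- Theta.2, Theta.1))%:E <=
   chord_length C Theta delta)%E.
Proof.
move=> CC Kp Kq; rewrite /chord_length; set T := (_, _).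
have KC : forall z w t, 0 <= t <= 1 -> chord C Theta delta z ->
    chord C Theta delta w -> chord C Theta delta (t *: z + (1 - t) *: w).
  move=> z w t t01 [Cz hz] [Cw hw]; split.
    exact: convex_set_segment.
  by rewrite dotDl !dotZl hz hw; ring.
set S := [set _ | _ in _].
have iS : is_interval S.
  move=> _ _ [z Kz <-] [w Kw <-] u /andP[zu uw].
  have [zw|zw] := eqVneq (dot z T) (dot w T).
    by exists z => //; apply/eqP; rewrite eq_le zu zw uw.
  have zw0 : 0 < dot w T - dot z T by rewrite subr_gt0 lt_neqAle zw (le_trans zu).
  exists ((dot w T - u) / (dot w T - dot z T) *: z +
          (1 - (dot w T - u) / (dot w T - dot z T)) *: w).
    apply: KC => //; rewrite divr_ge0 ?subr_ge0//= ?(ltW zw0)//.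
      by rewrite ler_pdivrMr// mul1r lerD2l lerN2.
    by rewrite (le_trans zu).
  rewrite dotDl !dotZl; field.
  by rewrite gt_eqF.
have [pq|qp] := leP (dot p T) (dot q T); last first.
  by apply: le_trans (measure_ge0 _ _); rewrite lee_fin; lra.
apply: (@le_trans _ _ (lebesgue_measure `[dot p T, dot q T]%classic)).
  rewrite lebesgue_measure_itv /= lte_fin.
  by case: ltgtP pq => // <-; rewrite subrr.
apply: le_measure; rewrite ?inE //.
  by move/is_intervalP : iS => ->; exact: measurable_itv.
move=> u /=; rewrite in_itv /= => puq; apply: iS puq; first by exists p.
by exists q.
Qed.

(** If the two points of the supporting line at distance r from the supporting
    point z are outside the oval by O(delta) on average, then each of them is,
    as both have gauge at least 1. Shrinking them to depth delta brings them into
    the oval, and their distance, at first 2 r, stays at least r. *)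
Lemma lame_chord_ge (R : realType) (s delta r : R) (Theta z : R * R) :
  1 / 2 <= s <= 1 -> Theta.1 ^+ 2 + Theta.2 ^+ 2 = 1 -> lame s z ->
  (forall u, lame s u -> dot u Theta <= dot z Theta) ->
  0 < delta <= 1 / 4 -> 0 <= r ->
  lame_gauge s (z + r *: (- Theta.2, Theta.1)) +
    lame_gauge s (z - r *: (- Theta.2, Theta.1)) <= 2 + delta / 2 ->
  (r%:E <= chord_length (lame s) Theta delta)%E.
Proof.
move=> s12 unit Cz zmax /andP[d0 d4] r0; set T := (_, _) => smooth.
have TT : dot T Theta = 0 by rewrite /dot /=; ring.
have := lame_support_value s12 unit Cz zmax.
move=> /andP[H1 H2]; set H := dot z Theta in H1 H2 zmax.
have dotw e : dot (z + e *: T) Theta = H by rewrite dotDl dotZl TT mulr0 addr0.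
have H0 : 0 < H by lra.
(* The homothety of ratio 1 - q about the origin moves the supporting line
   inwards by delta. *)
have [q [q0 q2 dq qH]] : exists q, [/\ 0 < q, q <= 1 / 2, delta / 2 <= q &
    (1 - q) * H = H - delta].
  exists (delta / H); split.
  - by rewrite divr_gt0.
  - by rewrite ler_pdivrMr//; nra.
  - by rewrite ler_pdivlMr// mulrAC ler_pdivrMr// ler_wpM2l// ltW.
  - by rewrite mulrBl mul1r divfK// gt_eqF.
pose mu := 1 - q.
have muH : mu * H = H - delta by [].
have mu01 : 0 <= mu <= 1.
  by rewrite /mu subr_ge0 gerBl (ltW q0) (le_trans q2)//; lra.
have mu_ge : mu * (1 + q) <= 1 by rewrite /mu; have := sqr_ge0 q; lra.
have mu2 : 1 <= 2 * mu by rewrite /mu; lra.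
have ge1 e : 1 <= lame_gauge s (z + e *: T).
  by apply: (@gauge_ge1_on_support_line R s Theta z) => //; rewrite dotw.
(* The minus sign moves the points from the supporting line at z to the opposite
   one, where the infimum defining the chord is attained. *)
have inC e : lame_gauge s (z + e *: T) <= 1 + delta / 2 ->
    chord (lame s) Theta delta (- mu *: (z + e *: T)).
  move=> ge; split.
    rewrite scaleNr /lame /= lame_gaugeN.
    apply: (le_trans (lame_gaugeZ _ s12 mu01)); apply: le_trans mu_ge.
    rewrite ler_wpM2l//; first by case/andP: mu01.
    by apply: (le_trans ge); rewrite lerD2l.
  rewrite (@inf_dot_symmetric _ _ _ z) => //; last first.
    by move=> u; rewrite /lame /= lame_gaugeN.
  by rewrite dotZl dotw mulNr muH opprB addrC.
have := ge1 r; have := ge1 (- r); rewrite scaleNr => gN gP.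
have Cp : chord (lame s) Theta delta (- mu *: (z + r *: T)) by apply: inC; lra.
have Cq : chord (lame s) Theta delta (- mu *: (z + (- r) *: T)).
  by apply: inC; rewrite scaleNr; lra.
have [_ conv _] := lame_convex_body s12.
apply: le_trans (chord_length_ge conv Cp Cq).
rewrite -/T lee_fin !dotZl !dotDl !dotZl.
have -> : dot T T = 1 by rewrite /dot /= mulrNN -!expr2 addrC.
rewrite -subr_ge0.
have -> : - mu * (dot z T + - r * 1) - - mu * (dot z T + r * 1) - r =
  r * (2 * mu - 1) by ring.
by rewrite mulr_ge0// subr_ge0.
Qed.

(** Here r ^ p = delta / 8, and the gauge is bounded by powR_clarkson. *)
Lemma lame_chord_sigma (R : realType) (s delta theta : R) :
  1 / 2 <= s <= 1 -> 0 < delta <= 1 / 4 ->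
  ((8^-1 `^ s * delta `^ s)%:E <= chord_length (lame s) (dir theta) delta)%E.
Proof.
move=> s12 d04; have /andP[d0 d4] := d04.
have unit : (dir theta).1 ^+ 2 + (dir theta).2 ^+ 2 = 1 by exact: cos2Dsin2.
have [z Cz zmax] := lame_support_exists (dir theta) s12.
have s0 : 0 < s by lra.
have sN0 : s != 0 by rewrite gt_eqF.
rewrite -powRM ?invr_ge0 ?(ltW d0)//; set r := (_ `^ s).
have r0 : 0 <= r by exact: powR_ge0.
have rp : r `^ s^-1 = 8^-1 * delta.
  by rewrite -powRrM mulfV// powRr1// mulr_ge0// ltW.
apply: (lame_chord_ge s12 unit Cz zmax d04) => //.
have p02 : 0 < s^-1 <= 2.
  by rewrite invr_gt0 s0 /= -[leRHS]invrK lef_pV2 ?posrE//; lra.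
have r1 : r <= 1.
  have <- : 1 `^ s = 1 :> R by rewrite powR1.
  apply: ge0_ler_powR; rewrite ?nnegrE ?(ltW s0) ?ler01//; last lra.
  by lra.
have r2 : r ^+ 2 <= r `^ s^-1.
  have [->|rN0] := eqVneq r 0; first by rewrite expr0n powR_ge0.
  rewrite -powR_mulrn// ger_powR//; last by case/andP: p02.
  by rewrite r1 andbT lt_neqAle eq_sym rN0.
have := @powR_clarkson R s^-1 z.2 (r * cos theta) p02.
have c1 : `|r * cos theta| `^ s^-1 <= r `^ s^-1.
  apply: ge0_ler_powR; rewrite ?nnegrE// ?invr_ge0 ?(ltW s0)//.
  rewrite normrM (ger0_norm r0) ler_piMr//.
  by rewrite ler_norml cos_geN1 cos_le1.
have sn : (r * sin theta) ^+ 2 <= r ^+ 2.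
  rewrite exprMn ler_piMr ?sqr_ge0// -(cos2Dsin2 theta) lerDr sqr_ge0 //.
move: Cz; rewrite /lame /lame_gauge /= /GRing.scale /= => Cz h.
by rewrite mulrN; nra.
Qed.

(** Since (0, 1) belongs to the oval, the supporting value is at least sin theta,
    which forces the supporting point to have ordinate at least 1 / 2, where
    powR_smooth applies; here r ^ 2 = delta / 16. *)
Lemma lame_chord_curved (R : realType) (s delta theta : R) :
  1 / 2 <= s <= 1 -> `|cos theta| <= 1 / 4 -> 1 / 2 <= sin theta ->
  0 < delta <= 1 / 4 ->
  ((4^-1 * delta `^ (1 / 2))%:E <= chord_length (lame s) (dir theta) delta)%E.
Proof.
move=> s12 cos4 sin2 d04; have /andP[d0 d4] := d04.
have unit : (dir theta).1 ^+ 2 + (dir theta).2 ^+ 2 = 1 by exact: cos2Dsin2.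
have [z Cz zmax] := lame_support_exists (dir theta) s12.
have s0 : 0 < s by lra.
set r := 4^-1 * _.
have r0 : 0 <= r by rewrite mulr_ge0 ?powR_ge0.
have r2 : r ^+ 2 = delta / 16.
  rewrite /r exprMn -[X in _ * X]powR_mulrn ?powR_ge0// -powRrM.
  have -> : 1 / 2 * 2%:R = 1 :> R by field.
  by rewrite powRr1 ?(ltW d0)//; field.
apply: (lame_chord_ge s12 unit Cz zmax d04) => //.
have p02 : 0 < s^-1 <= 2.
  by rewrite invr_gt0 s0 /= -[leRHS]invrK lef_pV2 ?posrE//; lra.
have [z1 z2] := (lame_sectionE z s12).1 Cz.
have f1 := profile_le1 z.1 s0.
have y2 : 2^-1 <= `|z.2| <= 1.
  rewrite (le_trans z2 f1) andbT.
  have [_ C01] := lame_axis_points s12.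
  have := zmax _ C01; rewrite /dot /= mul0r mul1r add0r.
  have : z.1 * cos theta <= 1 / 4.
    apply: (le_trans (ler_norm _)); rewrite normrM.
    by rewrite -[leRHS]mul1r ler_pM.
  have := ler_norm z.2; nra.
have := @powR_smooth R s^-1 z.2 (r * cos theta) p02 y2.
have cs := sqr_ge0 (cos theta); have ss := sqr_ge0 (sin theta).
have c2 : cos theta ^+ 2 = 1 - sin theta ^+ 2.
  by rewrite -(cos2Dsin2 theta) addrK.
move: Cz; rewrite /lame /lame_gauge /= /GRing.scale /= => Cz h.
have -> : (z.1 + r * - sin theta) ^+ 2 =
  z.1 ^+ 2 - 2 * z.1 * r * sin theta + r ^+ 2 * sin theta ^+ 2 by ring.
have -> : (z.1 - r * - sin theta) ^+ 2 =
  z.1 ^+ 2 + 2 * z.1 * r * sin theta + r ^+ 2 * sin theta ^+ 2 by ring.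
move: h; rewrite exprMn c2 r2; nra.
Qed.

Lemma lame_chords (R : realType) (s : R) : 1 / 2 <= s <= 1 ->
  exists (delta0 c1 c2 : R) (I : set R),
  [/\ [/\ 0 < delta0, 0 < c1 & 0 < c2],
      [/\ is_interval I, I `<=` `]- pi, pi[ &
          (0 < lebesgue_measure I)%E] &
      forall delta : R, 0 < delta <= delta0 ->
        (forall theta, I theta ->
           ((c1 * delta `^ (1 / 2))%:E <=
            chord_length (lame s) (- dir theta)%R delta +
            chord_length (lame s) (dir theta) delta)%E) /\
        (forall theta, (`]- pi, pi[ `\` I) theta ->
           ((c2 * delta `^ s)%:E <=
            chord_length (lame s) (- dir theta)%R delta +
            chord_length (lame s) (dir theta) delta)%E)].
Proof.
move=> s12.
(* Directions near the vertical one have their supporting point near (0, 1). *)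
have nbh : \forall t \near (pi / 2 : R), `|cos t| <= 1 / 4 /\ 1 / 2 <= sin t.
  near=> t; split.
    rewrite -[cos t]subr0 distrC -(@cos_pihalf R).
    near: t; apply: (@cvgr_dist_le _ _ _ _ _ _ _ (@continuous_cos R (pi / 2))).
    by lra.
  have : `|sin (pi / 2) - sin t| <= 1 / 2.
    near: t; apply: (@cvgr_dist_le _ _ _ _ _ _ _ (@continuous_sin R (pi / 2))).
    by lra.
  by rewrite sin_pihalf ler_norml; lra.
have [e /= e0 be] := (nbhs_ballP _ _).1 nbh.
pose e' := Num.min e 1.
have e'0 : 0 < e' by rewrite lt_min e0 /=.
have e'1 : e' <= 1 by rewrite ge_min lexx orbT.
have e'e : e' <= e by rewrite ge_min lexx.
have pi2 : 2 <= pi :> R by exact: pi_ge2.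
exists (1 / 4), 4^-1, (8^-1 `^ s), `](pi / 2 - e'), (pi / 2 + e')[%classic.
split.
- by split; rewrite ?powR_gt0//; lra.
- split; first exact: interval_is_interval.
    by move=> x /=; rewrite !in_itv /= => /andP[? ?]; apply/andP; split; lra.
  rewrite lebesgue_measure_itv /= lte_fin ifT; last by lra.
  by rewrite lte_fin; lra.
move=> d d0; split=> th.
  rewrite /= in_itv /= => /andP[h1 h2].
  have [c s'] : `|cos th| <= 1 / 4 /\ 1 / 2 <= sin th.
    by apply: be; rewrite /ball /= ltr_norml; apply/andP; split; lra.
  rewrite -[leLHS]add0e leeD ?measure_ge0//.
  exact: lame_chord_curved.
move=> _; rewrite -[leLHS]add0e leeD ?measure_ge0//.
exact: lame_chord_sigma.
Unshelve. all: by end_near. Qed.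

(** * Riemann sums of the section length *)

Lemma profile_edge (R : realType) (s h x : R) : 0 < s <= 1 -> 0 <= h ->
  1 - h <= `|x| -> profile s x <= 2 * h `^ s.
Proof.
move=> /andP[s0 s1] h0 xh; apply: (@le_trans _ _ ((2 * h) `^ s)).
  rewrite /profile; apply: ge0_ler_powR; rewrite ?nnegrE ?(ltW s0) ?le_max ?lexx//.
    by rewrite mulr_ge0.
  rewrite ge_max mulr_ge0//= -(real_normK (num_real x)).
  by have := normr_ge0 x; have := sqr_ge0 (1 - `|x|); rewrite !expr2; lra.
rewrite powRM// ler_wpM2r ?powR_ge0//.
by apply: ler1_powR; lra.
Qed.

Lemma profile_concave (R : realType) (s t x y : R) : 0 < s <= 1 ->
  0 <= t <= 1 -> -1 <= x <= 1 -> -1 <= y <= 1 ->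
  t * profile s x + (1 - t) * profile s y <= profile s (t * x + (1 - t) * y).
Proof.
move=> s01 /andP[t0 t1] /andP[x0 x1] /andP[y0 y1].
have /andP[s0 _] := s01.
have x2 : 0 <= 1 - x ^+ 2 by nra.
have y2 : 0 <= 1 - y ^+ 2 by nra.
have t01 : 0 <= t <= 1 by rewrite t0.
rewrite /profile !(max_idPr x2) !(max_idPr y2).
apply: (le_trans (powR_concave s01 t01 x2 y2)).
apply: ge0_ler_powR; rewrite ?nnegrE ?(ltW s0) ?le_max ?lexx//.
  by rewrite addr_ge0// mulr_ge0//; lra.
apply/orP; right.
have : 0 <= t * (1 - t) * (x - y) ^+ 2.
  by apply: mulr_ge0 (sqr_ge0 _); apply: mulr_ge0 => //; rewrite subr_ge0.
lra.
Qed.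

(** This step function jumps at both ends of [-1, 1], so that its increment over a
    cell [x, x + h] detects the cells containing an end point, and the sum of
    these increments telescopes. *)
Definition edge_step (R : realType) (x : R) : R := (-1 <= x)%R%:R + (1 < x)%R%:R.

(** Concavity gives the interpolation inequality for cells inside [-1, 1]. In a
    cell containing an end point, both values of the profile are at most
    2 * h ^ s, which the last term on the left compensates. *)
Lemma profile_interpolation (R : realType) (s h r x : R) : 0 < s <= 1 ->
  0 < h -> 0 <= r <= 1 ->
  (1 - r) * profile s x + r * profile s (x + h) -
    2 * h `^ s * (edge_step (x + h) - edge_step x) <= profile s (x + r * h).
Proof.
move=> s01 h0 r01; have /andP[s0 _] := s01; have /andP[r0 r1] := r01.
have hs := powR_ge0 h s.
have P0 := profile_ge0 s (x + r * h).
rewrite /edge_step.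
have [xN1|xN1] := ltP x (-1).
  rewrite (@profile_out _ _ x)//; last by left; lra.
  have -> : (1 < x) = false by apply/negbTE; rewrite -leNgt; lra.
  have [xh1|xh1] := leP (-1) (x + h).
    have [xh2|xh2] := ltP 1 (x + h).
      by rewrite (@profile_out _ _ (x + h))//; [rewrite /=; lra|right; lra].
    have : profile s (x + h) <= 2 * h `^ s.
      apply: profile_edge => //; first exact: ltW.
      by rewrite ler_normr; apply/orP; right; lra.
    by have := profile_ge0 s (x + h); rewrite /=; nra.
  have -> : (1 < x + h) = false by apply/negbTE; rewrite -leNgt; lra.
  by rewrite (@profile_out _ _ (x + h))//; [rewrite /=; lra|left; lra].
have -> : -1 <= x + h by lra.
have [xh1|xh1] := ltP 1 (x + h).
  rewrite (@profile_out _ _ (x + h))//; last by right; lra.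
  have [x1|x1] := ltP 1 x.
    by rewrite (@profile_out _ _ x)//; [rewrite /=; lra|right; lra].
  have : profile s x <= 2 * h `^ s.
    apply: profile_edge => //; first exact: ltW.
    by rewrite ler_normr; apply/orP; left; lra.
  by have := profile_ge0 s x; rewrite /=; nra.
have -> : (1 < x) = false by apply/negbTE; rewrite -leNgt; lra.
have -> : x + r * h = (1 - r) * x + (1 - (1 - r)) * (x + h) by ring.
rewrite subrr mulr0 subr0.
have {2}-> : r = 1 - (1 - r) by ring.
by apply: profile_concave => //; apply/andP; split; lra.
Qed.

(** Summing the interpolation inequality over all cells, the values at the nodes
    recombine with total weight 1 and the corrections telescope. *)
Lemma profile_sum_shift (R : realType) (s h r x : R) (K : nat) : 0 < s <= 1 ->
  0 < h -> 0 <= r <= 1 -> x <= -1 ->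
  \sum_(i < K) profile s (x + i%:R * h) - 4 * h `^ s <=
  \sum_(i < K) profile s (x + i%:R * h + r * h).
Proof.
move=> s01 h0 r01 x1; have /andP[s0 _] := s01; have /andP[r0 r1] := r01.
have hs := powR_ge0 h s.
have step (n : nat) : x + n.+1%:R * h = x + n%:R * h + h.
  by rewrite -natr1; ring.
suff : \sum_(i < K) profile s (x + i%:R * h) + r * profile s (x + K%:R * h)
    - 2 * h `^ s * (edge_step (x + K%:R * h) - edge_step x) <=
    \sum_(i < K) profile s (x + i%:R * h + r * h).
  apply: le_trans.
  have -> : edge_step x = (-1 <= x)%R%:R.
    rewrite /edge_step (_ : (1 < x) = false) ?addr0//.
    by apply/negbTE; rewrite -leNgt; lra.
  have : edge_step (x + K%:R * h) - (-1 <= x)%R%:R <= 2.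
    have b01 (b : bool) : (0 : R) <= b%:R /\ b%:R <= 1 :> R by case: b => /=; split.
    have [_ ?] := b01 (-1 <= x + K%:R * h); have [_ ?] := b01 (1 < x + K%:R * h).
    by have [? _] := b01 (-1 <= x); rewrite /edge_step; lra.
  by have := mulr_ge0 r0 (profile_ge0 s (x + K%:R * h)); nra.
elim: K => [|K IH].
  by rewrite !big_ord0 mul0r addr0 subrr profile_out ?mulr0 ?addr0 ?subr0//; left.
rewrite !big_ord_recr /= step.
have := profile_interpolation (x + K%:R * h) s01 h0 r01.
move: IH; set A := \sum_(_ < _) _; set B := \sum_(_ < _) _.
lra.
Qed.

(** This is profile_sum_shift again, with the two grids exchanged. *)
Lemma profile_sum_shift_le (R : realType) (s h r x : R) (K : nat) :
  0 < s <= 1 -> 0 < h -> 0 <= r <= 1 -> x + h <= -1 -> 1 <= x + K%:R * h ->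
  \sum_(i < K) profile s (x + i%:R * h + r * h) <=
  \sum_(i < K) profile s (x + i%:R * h) + 4 * h `^ s.
Proof.
move=> s01 h0 r01 x1 xK; have /andP[s0 _] := s01; have /andP[r0 r1] := r01.
have r'01 : 0 <= 1 - r <= 1 by lra.
(* Shifting the grid x + r * h once more, by the complementary amount 1 - r,
   gives back the original grid up to one node lying outside [-1, 1]. *)
have xr : x + r * h <= -1 by nra.
have := @profile_sum_shift R s h (1 - r) (x + r * h) K s01 h0 r'01 xr.
rewrite lerBlDr.
under eq_bigr do rewrite addrAC.
move=> H; apply: (le_trans H); rewrite lerD2r.
have E (i : nat) : x + r * h + i%:R * h + (1 - r) * h = x + i.+1%:R * h.
  by rewrite -natr1; ring.
under eq_bigr do rewrite E.
have : \sum_(i < K.+1) profile s (x + i%:R * h) =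
  profile s x + \sum_(i < K) profile s (x + i.+1%:R * h).
  by rewrite big_ord_recl mul0r addr0.
rewrite big_ord_recr /= (@profile_out _ _ (x + K%:R * h))//; last by right.
rewrite (@profile_out _ _ x)//; last by left; lra.
by rewrite addr0 add0r => ->.
Qed.

Lemma supported_integrable (R : realType) (f : R -> R) : continuous f ->
  (forall x : R, x <= -1 \/ 1 <= x -> f x = 0) ->
  (@lebesgue_measure R).-integrable setT (EFin \o f).
Proof.
move=> cf f0.
have -> : EFin \o f = (EFin \o f) \_ `[-1, 1].
  apply/funext => x; rewrite patchE; case: ifPn => //= xI.
  congr EFin; apply: f0.
  have [|x1] := leP x (-1); first by left.
  have [|x2] := leP 1 x; first by right.
  by move: xI; rewrite notin_setE /= in_itv /= !ltW.
have mI : measurable (`[-1, 1]%classic : set R) by exact: measurable_itv.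
have [+ _] := @integrable_mkcond _ _ R (@lebesgue_measure R) _ (EFin \o f) mI.
apply.
apply: continuous_compact_integrable; first exact: segment_compact.
exact: continuous_subspaceT.
Qed.

Lemma supported_antiderivative (R : realType) (f : R -> R) : continuous f ->
  (forall x : R, x <= -1 \/ 1 <= x -> f x = 0) ->
  exists Phi : R -> R, [/\ forall x : R, is_derive x (1 : R) Phi (f x),
    forall x : R, x <= -1 -> Phi x = 0 &
    forall x : R, 1 <= x -> (\int[lebesgue_measure]_x (f x)%:E = (Phi x)%:E)%E].
Proof.
move=> cf f0; have intf := supported_integrable cf f0.
have supp (D : set R) :
  (forall y, ~ D y -> f y = 0) -> (f \_ D) = f.
  move=> fD; apply/funext => y; rewrite patchE; case: ifPn => //.
  by rewrite notin_setE => /fD.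
exists (fun x => Rintegral lebesgue_measure `]-oo, x] f); split => x.
- have xx1 : x < x + 1 by lra.
  have intx : (@lebesgue_measure R).-integrable `]-oo, (x + 1)] (EFin \o f).
    by apply: integrableS intf.
  have [d1 d2] := continuous_FTC1 xx1 intx (ltNyr _) (cf x).
  by apply: DeriveDef; [exact: d1|rewrite -derive1E; exact: d2].
- move=> x1; rewrite /Rintegral integral0_eq// => y /=; rewrite in_itv /= => yx.
  by rewrite f0//; left; exact: le_trans x1.
- move=> x1; rewrite Rintegral_mkcond supp//.
    by rewrite /Rintegral fineK//; exact: integrable_fin_num.
  move=> y; rewrite /= in_itv /= => /negP; rewrite -ltNge => xy.
  by apply: f0; right; rewrite (le_trans x1)// ltW.
Qed.

(** The integral is the mean of the Riemann sums over all shifts of the grid, so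
    it equals one of them by the mean value theorem. *)
Lemma riemann_sum_mean (R : realType) (f : R -> R) (h x : R) (K : nat) :
  continuous f -> (forall x : R, x <= -1 \/ 1 <= x -> f x = 0) ->
  0 < h -> x <= -1 -> 1 <= x + K%:R * h ->
  exists2 r, 0 <= r <= 1 &
  (\int[lebesgue_measure]_x (f x)%:E =
    (h * \sum_(i < K) f (x + i%:R * h + r * h))%:E)%E.
Proof.
move=> cf f0 h0 x1 xK.
have [Phi [dPhi Phi0 PhiJ]] := supported_antiderivative cf f0.
(* The derivative of G at u is the Riemann sum shifted by u, and G h - G 0
   telescopes to the whole integral. *)
pose G := \sum_(i < K) (Phi \o (cst (x + i%:R * h) + id)).
have dG (u : R) : is_derive u (1 : R) G (\sum_(i < K) f (x + i%:R * h + u)).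
  apply: is_derive_sum => i.
  rewrite -[f _]mulr1.
  apply: is_derive1_comp.
  by rewrite -[X in is_derive _ _ _ X]add0r; exact: is_deriveD.
have cG : {within `[0, h], continuous G}.
  apply: continuous_subspaceT => u.
  by apply/differentiable_continuous/derivable1_diffP; case: (dG u).
have [c c0h Gc] := MVT h0 (fun u _ => dG u) cG.
move: c0h; rewrite in_itv /= => /andP[c0 ch].
exists (c / h).
  by rewrite divr_ge0 ?(ltW c0) ?(ltW h0)//= ler_pdivrMr// mul1r ltW.
rewrite (PhiJ _ xK); congr EFin.
under eq_bigr do rewrite divfK ?gt_eqF//.
move: Gc; rewrite subr0 mulrC => <-.
have -> : Phi (x + K%:R * h) = Phi (x + K%:R * h) - Phi x by rewrite (Phi0 x x1) subr0.
rewrite /G !fct_sumE /= -sumrB.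
have E (i : nat) : Phi ((cst (x + i%:R * h) + id) h) - Phi ((cst (x + i%:R * h) + id) 0) =
   Phi (x + i.+1%:R * h) - Phi (x + i%:R * h).
  have e (a u : R) : (cst a + id) u = a + u by [].
  by rewrite !e addr0 -natr1 mulrDl mul1r addrA.
under [RHS]eq_bigr do rewrite E.
rewrite -(big_mkord xpredT (fun i => Phi (x + i.+1%:R * h) - Phi (x + i%:R * h))).
by rewrite telescope_sumr// mul0r addr0.
Qed.

(** All Riemann sums of mesh h are close to each other and the integral is one
    of them. *)
Lemma profile_riemann_sum (R : realType) (s h x J : R) (K : nat) :
  1 / 2 <= s <= 1 ->
  (\int[lebesgue_measure]_x (profile s x)%:E = J%:E)%E ->
  0 < h -> x + h <= -1 -> 1 <= x + K%:R * h ->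
  `|h * \sum_(i < K) profile s (x + i%:R * h) - J| <= 4 * (h * h `^ s).
Proof.
move=> s12 JE h0 xh xK; have s01 : 0 < s <= 1 by lra.
have /andP[s0 s1] := s01.
have x1 : x <= -1 by lra.
have := @riemann_sum_mean R (profile s) h x K (profile_continuous s12)
  (fun x => @profile_out R s x s0) h0 x1 xK.
rewrite JE => -[r r01 [->]].
have := profile_sum_shift K s01 h0 r01 x1.
have := profile_sum_shift_le s01 h0 r01 xh xK.
set A := \sum_(_ < _) _; set B := \sum_(_ < _) _ => h1 h2.
rewrite -mulrBr normrM (gtr0_norm h0) mulrCA ler_pM2l// ler_norml.
by apply/andP; split; lra.
Qed.

Lemma lame_area (R : realType) (s : R) : 1 / 2 <= s <= 1 ->
  exists2 J : R, (\int[lebesgue_measure]_x (profile s x)%:E = J%:E)%E &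
    area (lame s) = (2 * J)%:E.
Proof.
move=> s12; have s0 : 0 < s by lra.
have intf := supported_integrable (profile_continuous s12)
  (fun x => @profile_out R s x s0).
exists (Rintegral lebesgue_measure setT (profile s)).
  by rewrite /Rintegral fineK//; exact: integrable_fin_num.
rewrite EFinM /Rintegral fineK; last exact: integrable_fin_num.
rewrite -integralZl//; apply: eq_integral => x _ /=.
have -> : xsection (lame s) x =
   if `|x| <= 1 then `[- profile s x, profile s x]%classic else set0.
  apply/seteqP; split => y; rewrite /xsection /= inE.
    move=> /(lame_sectionE _ s12) /= [-> yx].
    by rewrite /= in_itv /= -ler_norml.
  case: ifPn => // x1; rewrite /= in_itv /= -ler_norml => yx.
  exact/lame_sectionE.
have P0 := profile_ge0 s x.
case: ifPn => [x1|]; last first.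
  rewrite -ltNge lter_normr => x1; rewrite measure0 profile_out ?mule0//.
  by case/orP: x1 => x1; [right|left]; lra.
rewrite lebesgue_measure_itv /= lte_fin.
case: ltP => [h|h]; first by rewrite -EFinM; congr EFin; ring.
have -> : profile s x = 0 by lra.
by rewrite mule0.
Qed.

(** * Superadditivity of integrals of nonnegative functions *)

Section LowerIntegral.
Local Open Scope ereal_scope.
Context d (T : measurableType d) (R : realType).
Variable mu : {measure set T -> \bar R}.
Implicit Types (f g : T -> \bar R) (D : set T).

Import HBNNSimple.

Lemma ge0_le_lower_integral D f g :
  (forall x, D x -> 0 <= f x) -> (forall x, D x -> f x <= g x) ->
  \int[mu]_(x in D) f x <= \int[mu]_(x in D) g x.
Proof.
move=> f0 fg.
have g0 x : D x -> 0 <= g x by move=> Dx; exact: le_trans (f0 _ Dx) (fg _ Dx).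
rewrite !ge0_integralE//; apply: ereal_sup_le => _ [h /= hf <-].
by exists h => // x; apply: (le_trans (hf x)); exact: lee_restrict.
Qed.

Lemma ge0_lower_integralD D f g :
  (forall x, D x -> 0 <= f x) -> (forall x, D x -> 0 <= g x) ->
  \int[mu]_(x in D) f x + \int[mu]_(x in D) g x <= \int[mu]_(x in D) (f x + g x).
Proof.
move=> f0 g0.
have fg0 x : D x -> 0 <= f x + g x by move=> Dx; rewrite adde_ge0 ?f0 ?g0.
(* The integrals are suprema of nonempty sets of nonnegative values; two
   successive passages to the supremum bound their sum. *)
have sup_add (S : set (\bar R)) (c X : \bar R) : 0 <= c -> S 0 ->
    (forall x, S x -> x + c <= X) -> ereal_sup S + c <= X.
  case: c => [c| |]// c0 S0 SX.
    by rewrite -leeBrDr//; apply: ge_ereal_sup => x Sx; rewrite leeBrDr// SX.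
  by have := SX _ S0; rewrite add0e leye_eq => /eqP ->; exact: leey.
have zero_in k : (forall x, D x -> 0 <= k x) ->
    [set sintegral mu h | h in
      [set h : {nnsfun T >-> R} | forall x, (h x)%:E <= (k \_ D) x]] 0.
  move=> k0; exists nnsfun0; last exact: sintegral0.
  by move=> x /=; exact: erestrict_ge0.
rewrite ge0_integralE//; apply: (sup_add); [exact: integral_ge0|exact: (zero_in)|].
move=> _ [h1 /= h1f <-]; rewrite addeC ge0_integralE//.
apply: (sup_add); [exact: sintegral_ge0|exact: (zero_in)|].
move=> _ [h2 /= h2g <-]; rewrite ge0_integralE//.
rewrite -sintegralD//; apply: ereal_sup_ubound => /=.
exists (add_nnsfun h2 h1) => //= x.
have := h1f x; have := h2g x; rewrite !patchE.
case: ifPn => xD hg hf; first by rewrite EFinD addeC leeD.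
by rewrite EFinD -[leRHS]adde0 leeD.
Qed.

Lemma ge0_lower_integral_sum (I : Type) (r : seq I) D (f : I -> T -> \bar R) :
  (forall i x, D x -> 0 <= f i x) ->
  \sum_(i <- r) \int[mu]_(x in D) f i x <=
  \int[mu]_(x in D) \sum_(i <- r) f i x.
Proof.
move=> f0; elim: r => [|i r IH].
  by rewrite big_nil integral_ge0// => x _; rewrite big_nil.
rewrite big_cons; under [leRHS]eq_integral do rewrite big_cons.
apply: le_trans (ge0_lower_integralD _ _); last 2 first.
- by move=> x Dx; exact: f0.
- by move=> x Dx; apply: sume_ge0 => j _; exact: f0.
by rewrite leeD2l.
Qed.

End LowerIntegral.

(** * Counting integers and averaging over shifts *)

Section Counting.
Variable R : realType.

Lemma count_le_bounds (K : nat) (b : R) : 0 <= b -> b < K%:R ->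
  b < \sum_(n < K) (n%:R <= b)%R%:R <= b + 1.
Proof.
move=> b0 bK.
have lek k : \sum_(n < k) (n%:R <= b)%R%:R <= k%:R :> R.
  rewrite -[in leRHS](card_ord k) -sumr_const; apply: ler_sum => i _.
  by rewrite lern1 leq_b1.
suff : [/\ K%:R <= b -> \sum_(n < K) (n%:R <= b)%R%:R = K%:R :> R,
   b < K%:R -> b < \sum_(n < K) (n%:R <= b)%R%:R &
   \sum_(n < K) (n%:R <= b)%R%:R <= b + 1].
  by case=> _ h1 h2; rewrite h1.
elim: K {bK} => [|k [IH1 IH2 IH3]].
  by rewrite big_ord0; split => //; lra.
rewrite big_ord_recr /=; have := lek k; move: IH1 IH2 IH3; rewrite -natr1.
set S := \sum_(_ < _) _ => IH1 IH2 IH3 Sk.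
have [kb|bk] := leP k%:R b.
  by have e := IH1 kb; rewrite e; split=> /=; lra.
by have := IH2 bk; split=> /=; lra.
Qed.

Lemma count_lt_bounds (K : nat) (a : R) : 0 <= a -> a <= K%:R ->
  a <= \sum_(n < K) (n%:R < a)%R%:R <= a + 1.
Proof.
move=> a0 aK.
have lek k : \sum_(n < k) (n%:R < a)%R%:R <= k%:R :> R.
  rewrite -[in leRHS](card_ord k) -sumr_const; apply: ler_sum => i _.
  by rewrite lern1 leq_b1.
suff : [/\ K%:R <= a -> \sum_(n < K) (n%:R < a)%R%:R = K%:R :> R,
   a <= K%:R -> a <= \sum_(n < K) (n%:R < a)%R%:R &
   \sum_(n < K) (n%:R < a)%R%:R <= a + 1].
  by case=> _ h1 h2; rewrite h1.
elim: K {aK} => [|k [IH1 IH2 IH3]].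
  by rewrite big_ord0; split => //; lra.
rewrite big_ord_recr /=; have := lek k; move: IH1 IH2 IH3; rewrite -natr1.
set S := \sum_(_ < _) _ => IH1 IH2 IH3 Sk.
have [ka|ak] := ltP k%:R a.
  by have e := IH1 (ltW ka); rewrite e; split=> /=; lra.
by have := IH2 ak; split=> /=; lra.
Qed.

(** The integers at distance at most r from c are those that are at most c + r but
    not less than c - r. *)
Lemma count_ball_bounds (K : nat) (c r : R) : 0 <= r -> r <= c -> c + r < K%:R ->
  `|\sum_(n < K) (`|n%:R - c| <= r)%R%:R - 2 * r| <= 1.
Proof.
move=> r0 rc crK.
have cb := @count_le_bounds K (c + r) ltac:(lra) crK.
have ca := @count_lt_bounds K (c - r) ltac:(lra) ltac:(lra).
have -> : \sum_(n < K) (`|n%:R - c| <= r)%R%:R =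
  \sum_(n < K) (n%:R <= c + r)%R%:R - \sum_(n < K) (n%:R < c - r)%R%:R :> R.
  rewrite -sumrB; apply: eq_bigr => n _.
  have -> : (`|n%:R - c| <= r) = (c - r <= n%:R) && (n%:R <= c + r).
    rewrite ler_norml; congr (_ && _); apply/idP/idP; lra.
  rewrite leNgt; case: ltP => [h1|h1] /=; last by rewrite subr0.
  have -> : n%:R <= c + r by lra.
  by rewrite subrr.
move: cb ca; set X := \sum_(_ < _) _; set Y := \sum_(_ < _) _.
by move=> /andP[? ?] /andP[? ?]; rewrite ler_norml; apply/andP; split; lra.
Qed.

Lemma sum_block (n k : nat) (g : nat -> R) :
  \sum_(i < k) \sum_(a < n) g (i * n + a)%N = \sum_(j < k * n) g j.
Proof.
elim: k => [|k IH]; first by rewrite big_ord0 big_ord0.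
rewrite big_ord_recr /= IH -[RHS](big_mkord xpredT g).
rewrite (big_cat_nat (n := (k * n)%N))//=; last by rewrite leq_mul2r leqnSn orbT.
rewrite big_mkord; congr (_ + _).
rewrite -{2}[(k * n)%N]add0n big_addn mulSn addnK big_mkord.
by apply: eq_bigr => i _; rewrite addnC.
Qed.

End Counting.

(** For independent uniform shifts, a product of two terms from different columns
    averages to the product of their means, each at most c / M in modulus; only
    the B diagonal terms contribute c ^ 2. *)
Lemma second_moment_shifts (R : realType) (B M : nat) (c : R)
    (g : 'I_B -> 'I_M -> R) : (0 < M)%N ->
  (forall b r, `|g b r| <= c) -> (forall b, `|\sum_r g b r| <= c) ->
  \sum_(xi : {ffun 'I_B -> 'I_M}) (\sum_b g b (xi b)) ^+ 2 <=
  #|{ffun 'I_B -> 'I_M}|%:R * (c ^+ 2 * B%:R + c ^+ 2 * (B%:R / M%:R) ^+ 2).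
Proof.
move=> M0 gc sc; set N := #|_|%:R.
have M0' : 0 < M%:R :> R by rewrite ltr0n.
have N0 : 0 <= N by rewrite ler0n.
have NE : N = M%:R ^+ B.
  by rewrite /N card_ffun !card_ord natrX.
have off b b' : b != b' ->
    \sum_(xi : {ffun 'I_B -> 'I_M}) g b (xi b) * g b' (xi b') =
    N * ((\sum_r g b r) / M%:R * ((\sum_r g b' r) / M%:R)).
  move=> bb'.
  (* The product over all columns of F i (xi i) is the product of two factors,
     times the uniform probability N^-1 of xi. *)
  pose h i r : R := if i == b then g b r else if i == b' then g b' r else 1.
  pose F i r : R := M%:R^-1 * h i r.
  have hE (xi : {ffun 'I_B -> 'I_M}) :
      \prod_i h i (xi i) = g b (xi b) * g b' (xi b').
    rewrite (bigD1 b)//= (bigD1 b')/=; last by rewrite eq_sym.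
    rewrite /h eqxx eq_sym (negbTE bb') eqxx big1 ?mulr1//.
    by move=> i /andP[/negbTE -> /negbTE ->].
  have E : \prod_i \sum_r F i r =
      N^-1 * \sum_(xi : {ffun 'I_B -> 'I_M}) g b (xi b) * g b' (xi b').
    rewrite bigA_distr_bigA mulr_sumr; apply: eq_bigr => xi _.
    by rewrite /F big_split /= prodr_const card_ord hE exprVn NE.
  have NN0 : N != 0 by rewrite NE expf_neq0// gt_eqF.
  have <- : N * (N^-1 * \sum_(xi : {ffun 'I_B -> 'I_M}) g b (xi b) * g b' (xi b')) =
    \sum_(xi : {ffun 'I_B -> 'I_M}) g b (xi b) * g b' (xi b').
    by rewrite mulrA mulfV// mul1r.
  rewrite -E (bigD1 b)//= (bigD1 b')/=; last by rewrite eq_sym.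
  rewrite [X in N * (_ * (_ * X)) = _]big1 ?mulr1; last first.
    move=> i /andP[/negbTE ib /negbTE ib']; rewrite /F /h ib ib'.
    by rewrite mulr1 sumr_const card_ord -[X in X = _]mulr_natr mulVf// gt_eqF.
  rewrite /F /h eqxx eq_sym (negbTE bb') eqxx -!mulr_sumr.
  by rewrite [_^-1 * _]mulrC [X in _ * (_ * X)]mulrC.
have term b b' : \sum_(xi : {ffun 'I_B -> 'I_M}) g b (xi b) * g b' (xi b') <=
    N * ((b == b')%:R * c ^+ 2 + c ^+ 2 / M%:R ^+ 2).
  have c0 : 0 <= c ^+ 2 / M%:R ^+ 2 by rewrite divr_ge0 ?sqr_ge0.
  have [<-|bb'] := eqVneq b b'.
    apply: (@le_trans _ _ (N * c ^+ 2)); last first.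
      by rewrite ler_wpM2l//= mul1r lerDl.
    have -> : N * c ^+ 2 = \sum_(xi : {ffun 'I_B -> 'I_M}) c ^+ 2.
      by rewrite sumr_const mulr_natl.
    apply: ler_sum => xi _; rewrite -expr2 -[X in X <= _]real_normK ?num_real//.
    by rewrite lerXn2r ?nnegrE// (le_trans (normr_ge0 _) (gc b (xi b))).
  rewrite off//= mul0r add0r ler_wpM2l//.
  rewrite mulrACA -invfM -expr2 ler_wpM2r ?invr_ge0 ?sqr_ge0//.
  by rewrite (le_trans (ler_norm _))// normrM expr2 ler_pM.
under eq_bigr do rewrite expr2 big_distrlr /=.
rewrite exchange_big /=; under eq_bigr do rewrite exchange_big /=.
apply: (@le_trans _ _ (\sum_b \sum_b' N * ((b == b')%:R * c ^+ 2 + c ^+ 2 / M%:R ^+ 2))).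
  by apply: ler_sum => b _; apply: ler_sum => b' _; exact: term.
have row (b : 'I_B) : \sum_b' N * ((b == b')%:R * c ^+ 2 + c ^+ 2 / M%:R ^+ 2) =
    N * (c ^+ 2 + c ^+ 2 / M%:R ^+ 2 * B%:R).
  rewrite -mulr_sumr big_split /= -mulr_suml sumr_const card_ord mulr_natr.
  rewrite (bigD1 b)//= eqxx big1 ?addr0 ?mul1r// => i.
  by rewrite eq_sym => /negbTE ->.
rewrite (eq_bigr _ (fun b _ => row b)) sumr_const card_ord -mulrnAr.
rewrite ler_wpM2l// -mulr_natr le_eqVlt; apply/orP; left; apply/eqP.
by rewrite expr_div_n; ring.
Qed.

(** * Columns of shifted points *)

Lemma esum_finite_support (R : realType) (I : choiceType) (r : seq I)
    (F : I -> \bar R) : uniq r -> (forall i, 0 <= F i)%E ->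
  (forall i, i \notin r -> F i = 0%E) ->
  (\esum_(i in [set: I]) F i = \sum_(i <- r) F i)%E.
Proof.
move=> ur F0 Fr; transitivity (\esum_(i in [set` r]) F i)%E.
  rewrite [RHS]esum_mkcond; apply: eq_esum => i _.
  by rewrite mem_setE; case: ifPn => // /Fr.
rewrite esum_fset; last by move=> i _; exact: F0.
  by rewrite -fsbig_seq.
exact: finite_seq.
Qed.

Lemma esum_int2_window (R : realType) (F : int * int -> R) :
  (forall k, 0 <= F k) ->
  (forall k, F k != 0 -> (`|k.1| <= 2) && (`|k.2| <= 2)) ->
  (\esum_(k in [set: int * int]) (F k)%:E =
   (\sum_(j < 5) \sum_(i < 5) F (j%:Z - 2, i%:Z - 2))%:E)%E.
Proof.
move=> F0 Fw.
pose h (p : 'I_5 * 'I_5) : int * int := (p.1%:Z - 2, p.2%:Z - 2).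
have hinj : injective h.
  move=> [a b] [c d] [/addIr [ac] /addIr [bd]].
  by congr (_, _); exact: val_inj.
rewrite (@esum_finite_support _ _ [seq h p | p <- enum {: 'I_5 * 'I_5}]).
- rewrite big_map big_enum /= sumEFin; congr EFin.
  by rewrite pair_bigA.
- by rewrite map_inj_uniq// enum_uniq.
- by move=> k; rewrite lee_fin.
suff H (k : int * int) : k \notin [seq h p | p <- enum {: 'I_5 * 'I_5}] -> F k = 0.
  by move=> k /H ->.
move: k => [k1 k2] kh; apply/eqP; apply: contraNT kh => /Fw /=.
move=> /andP[h1 h2]; apply/mapP.
have b1 : (absz (k1 + 2)%R < 5)%N by lia.
have b2 : (absz (k2 + 2)%R < 5)%N by lia.
exists (Ordinal b1, Ordinal b2); first by rewrite mem_enum.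
by rewrite /h /=; congr (_, _); lia.
Qed.

Section Grid.
Variables (R : realType) (A B M : nat).
Hypotheses (A0 : (0 < A)%N) (B0 : (0 < B)%N) (M0 : (0 < M)%N).

Definition grid_point (xi : 'I_B -> 'I_M) (p : 'I_B * 'I_A) : R * R :=
  (p.1%:R / B%:R, (p.2 * M + xi p.1)%:R / (A * M)%:R).

Definition shifted_grid (xi : 'I_B -> 'I_M) : {fset R * R} :=
  [fset grid_point xi p | p in {: 'I_B * 'I_A}]%fset.

Lemma grid_point_inj xi : injective (grid_point xi).
Proof using A0 B0 M0.
have b0 : B%:R != 0 :> R by rewrite pnatr_eq0 -lt0n.
have am0 : (A * M)%:R != 0 :> R by rewrite pnatr_eq0 -lt0n muln_gt0 A0.
move=> [b a] [b' a'] [].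
move=> /(mulIf (invr_neq0 b0)) /eqP; rewrite eqr_nat => /eqP /val_inj <-.
move=> /(mulIf (invr_neq0 am0)) /eqP; rewrite eqr_nat eqn_add2r.
by rewrite eqn_mul2r (gtn_eqF M0) => /eqP /val_inj <-.
Qed.

Lemma card_shifted_grid xi : #|` shifted_grid xi| = (A * B)%N.
Proof using A0 B0 M0.
rewrite card_imfset; last exact: grid_point_inj.
by rewrite -cardE card_prod !card_ord mulnC.
Qed.

Lemma big_shifted_grid xi (F : R * R -> \bar R) :
  (\sum_(u <- shifted_grid xi) F u = \sum_b \sum_a F (grid_point xi (b, a)))%E.
Proof using A0 B0 M0.
rewrite big_imfset/=; last by move=> p q _ _; exact: grid_point_inj.
by rewrite big_enum /= pair_bigA; apply: eq_bigr => -[].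
Qed.

Lemma shifted_grid_torus xi : [set` shifted_grid xi] `<=` torus R.
Proof using A0 B0 M0.
move=> u /= /imfsetP[[b a] _ ->] /=; split => /=; rewrite in_itv /=.
  by rewrite divr_ge0//= ltr_pdivrMr ?ltr0n// mul1r ltr_nat.
rewrite divr_ge0//= ltr_pdivrMr ?ltr0n ?muln_gt0 ?A0// mul1r ltr_nat.
apply: (@leq_trans (a * M + M)); first by rewrite ltn_add2l.
by rewrite -mulSnr leq_mul2r ltn_ord orbT.
Qed.

Definition column_count (w y : R) (r : nat) : R :=
  \sum_(i < 5) \sum_(a < A)
    (`|(a * M + r)%:R / (A * M)%:R - y + (i%:R - 2)| <= w)%R%:R.

Lemma column_count_bound (w y : R) (r : nat) : 0 <= w <= 1 -> 0 <= y < 1 ->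
  (r < M)%N -> `|column_count w y r - 2 * A%:R * w| <= 1.
Proof using A0 M0.
move=> /andP[w0 w1] /andP[y0 y1] rM.
have a0 : 0 < A%:R :> R by rewrite ltr0n.
have a1 : 1 <= A%:R :> R by rewrite ler1n.
have m0 : 0 < M%:R :> R by rewrite ltr0n.
have rm0 : 0 <= r%:R / M%:R :> R by rewrite divr_ge0.
have rm1 : r%:R / M%:R <= 1 :> R by rewrite ler_pdivrMr// mul1r ler_nat ltnW.
(* Scaling by A turns the column into the integers 0, .., 5 * A - 1: the five
   periods i - 2 range from -2 to 2. *)
pose c : R := A%:R * (2 + y) - r%:R / M%:R.
have -> : column_count w y r = \sum_(n < 5 * A) (`|n%:R - c| <= A%:R * w)%R%:R.
  rewrite -(sum_block _ _ (fun n => (`|n%:R - c| <= A%:R * w)%R%:R)).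
  apply: eq_bigr => i _; apply: eq_bigr => a _; congr (nat_of_bool _)%:R.
  rewrite -(ler_pM2l a0) -{1}(ger0_norm (ltW a0)) -normrM /c.
  congr (`|_| <= _); rewrite !natrD !natrM; field.
  by rewrite !gt_eqF.
have -> : 2 * A%:R * w = 2 * (A%:R * w) by rewrite mulrA.
apply: count_ball_bounds; rewrite /c ?natrM.
- by rewrite mulr_ge0// ltW.
- by nra.
- by nra.
Qed.

(** The M-fold refinement of a column is again an equally spaced column, for which
    the counting error is O(1); so the errors of the shifted columns nearly cancel
    instead of adding up. *)
Lemma column_count_average (w y : R) : 0 <= w <= 1 -> 0 <= y < 1 ->
  `|\sum_(r < M) (column_count w y r - 2 * A%:R * w)| <= 1.
Proof using A0 M0.
move=> /andP[w0 w1] /andP[y0 y1].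
have am0 : 0 < (A * M)%:R :> R by rewrite ltr0n muln_gt0 A0.
have am1 : 1 <= (A * M)%:R :> R by rewrite ler1n muln_gt0 A0.
(* The M shifted columns interleave into one column of mesh 1 / (A * M). *)
pose c : R := (A * M)%:R * (2 + y).
pose g n : R := (`|n%:R - c| <= (A * M)%:R * w)%R%:R.
have -> : \sum_(r < M) (column_count w y r - 2 * A%:R * w) =
    \sum_(n < 5 * A * M) g n - 2 * ((A * M)%:R * w).
  rewrite sumrB sumr_const card_ord -[_ *+ M]mulr_natr natrM; congr (_ - _); last by ring.
  rewrite -sum_block -(sum_block _ _ (fun n => \sum_(r < M) g (n * M + r)%N)).
  rewrite exchange_big; apply: eq_bigr => i _.
  rewrite exchange_big; apply: eq_bigr => a _; apply: eq_bigr => r _.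
  congr (nat_of_bool _)%:R.
  rewrite -(ler_pM2l am0) -{1}(ger0_norm (ltW am0)) -normrM /c.
  congr (`|_| <= _); rewrite mulnDl !natrD !natrM; field.
  by move: am0; rewrite natrM pmulr_rgt0 ?ltr0n// => m0; rewrite !gt_eqF ?ltr0n.
apply: count_ball_bounds; rewrite /c.
- by rewrite mulr_ge0// ltW.
- by nra.
- by rewrite -mulnA natrM; nra.
Qed.

End Grid.

(** * Discrepancy of the shifted grids *)

(** Half the length of the vertical section at x of the oval dilated by lambda. *)
Definition half_width (R : realType) (s lambda x : R) : R :=
  lambda * profile s (x / lambda).

Lemma half_width_bounds (R : realType) (s lambda x : R) : 1 / 2 <= s <= 1 ->
  0 <= lambda <= 1 -> 0 <= half_width s lambda x <= 1.
Proof.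
move=> s12 /andP[l0 l1]; have s0 : 0 < s by lra.
have P0 := profile_ge0 s (x / lambda); have P1 := profile_le1 (x / lambda) s0.
by rewrite /half_width mulr_ge0//= mulr_ile1.
Qed.

Lemma half_width_out (R : realType) (s lambda x : R) : 1 / 2 <= s <= 1 ->
  0 <= lambda -> lambda < `|x| -> half_width s lambda x = 0.
Proof.
move=> s12 l0 lx; rewrite /half_width.
have [->|lN0] := eqVneq lambda 0; first by rewrite mul0r.
have {}l0 : 0 < lambda by rewrite lt_neqAle eq_sym lN0.
rewrite profile_out ?mulr0//; first by lra.
rewrite ler_pdivrMr// ler_pdivlMr// mulN1r mul1r.
by move: lx; rewrite lter_normr => /orP[|] ?; [right|left]; lra.
Qed.

Lemma dilate_lameE (R : realType) (s lambda : R) (u : R * R) :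
  1 / 2 <= s <= 1 -> 0 <= lambda ->
  dilate lambda (lame s) u <->
  (`|u.1| <= lambda) && (`|u.2| <= half_width s lambda u.1).
Proof.
move=> s12 l0; rewrite /half_width; have [->|lN0] := eqVneq lambda 0.
  rewrite mul0r !normr_le0; split.
    by move=> [x _ <-] /=; rewrite !scale0r !eqxx.
  move=> /andP[/eqP u1 /eqP u2]; exists 0.
    by rewrite /lame /= lame_gauge0.
  by rewrite scaler0 [u]surjective_pairing u1 u2.
have {}l0 : 0 < lambda by rewrite lt_neqAle eq_sym lN0.
split.
  move=> [x /(lame_sectionE _ s12)[x1 x2] <-] /=.
  rewrite !normrM (gtr0_norm l0) mulrAC mulfV// mul1r.
  by rewrite -[leRHS]mulr1 !ler_pM2l// x1.
move=> /andP[u1 u2]; exists (lambda^-1 *: u).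
  have e1 : (lambda^-1 *: u).1 = u.1 / lambda by rewrite mulrC.
  have e2 : (lambda^-1 *: u).2 = u.2 / lambda by rewrite mulrC.
  apply/lame_sectionE => //; rewrite e1 e2 !normrM normfV (gtr0_norm l0).
  by rewrite !ler_pdivrMr// mul1r mulrC.
by rewrite scalerA mulfV// scale1r.
Qed.

(** The abscissa, relative to x, of the copy of column b in the period j - 2. *)
Definition column (R : realType) (B : nat) (x : R) (b j : nat) : R :=
  b%:R / B%:R - x + (j%:R - 2).

Lemma int_shift_bound (R : realType) (k : int) (x y : R) :
  0 <= x -> x < 1 -> 0 <= y -> y < 1 -> `|x - y + k%:~R| <= 1 -> `|k| <= 2.
Proof.
move=> x0 x1 y0 y1; rewrite ler_norml => /andP[h1 h2].
have h3 : (k%:~R : R) < 2%:~R by lra.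
have h4 : ((-2)%:~R : R) < k%:~R by rewrite mulrNz; lra.
by rewrite ler_norml -!(ler_int R) !ltW.
Qed.

Lemma card_translate_grid (R : realType) (s lambda : R) (A B M : nat)
    (xi : 'I_B -> 'I_M) (t : R * R) :
  (0 < A)%N -> (0 < B)%N -> (0 < M)%N ->
  1 / 2 <= s <= 1 -> 0 <= lambda <= 1 -> torus R t ->
  card_translate (shifted_grid R A xi) (dilate lambda (lame s)) t =
  (\sum_(b < B) \sum_(j < 5) (`|column B t.1 b j| <= lambda)%R%:R *
     column_count A M (half_width s lambda (column B t.1 b j)) t.2 (xi b))%:E.
Proof.
move=> A0 B0 M0 s12 l01 [t1 t2]; have /andP[l0 l1] := l01.
rewrite /card_translate big_shifted_grid// -sumEFin; apply: eq_bigr => b _.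
transitivity (\sum_(a < A) (\sum_(j < 5) \sum_(i < 5)
   \1_(dilate lambda (lame s)) (grid_point R xi (b, a) - t +
      ((j%:Z - 2)%:~R, (i%:Z - 2)%:~R)) : R)%R%:E)%E.
  apply: eq_bigr => a _.
  rewrite (@esum_int2_window R (fun k => \1_(dilate lambda (lame s))
     (grid_point R xi (b, a) - t + (k.1%:~R, k.2%:~R))))//.
  move=> k; rewrite indicE pnatr_eq0 eqb0 negbK inE.
  move=> /(dilate_lameE _ s12 l0) /andP[] /=.
  have := @shifted_grid_torus R A B M A0 B0 M0 xi (grid_point R xi (b, a)).
  case; first by apply/imfsetP; exists (b, a).
  move: t1 t2; rewrite /= !in_itv /=.
  move=> /andP[ta tb] /andP[tc td] /andP[pa pb] /andP[pc pd] u1 u2.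
  rewrite (int_shift_bound pa pb ta tb (le_trans u1 l1)).
  apply: (int_shift_bound pc pd tc td); apply: (le_trans u2).
  by have /andP[] := half_width_bounds (b%:R / B%:R - t.1 + k.1%:~R) s12 l01.
rewrite sumEFin; congr EFin; rewrite exchange_big; apply: eq_bigr => j _.
rewrite exchange_big mulr_sumr; apply: eq_bigr => i _.
rewrite mulr_sumr; apply: eq_bigr => a _.
rewrite indicE -natrM mulnb; congr (nat_of_bool _)%:R.
have E (n : nat) : (n%:Z - 2)%:~R = n%:R - 2 :> R by rewrite intrB.
rewrite !E; apply/idP/idP.
  by rewrite inE => /(dilate_lameE _ s12 l0).
by move=> h; rewrite inE; apply/(dilate_lameE _ s12 l0).
Qed.

(** The columns cut the dilated oval in a Riemann sum of mesh 1 / (B * lambda) of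
    the profile; the five periods j - 2 cover the whole oval. *)
Lemma column_area_error (R : realType) (s lambda x J : R) (B : nat) :
  (0 < B)%N -> 1 / 2 <= s <= 1 -> 0 <= lambda <= 1 -> 0 <= x < 1 ->
  (\int[lebesgue_measure]_x (profile s x)%:E = J%:E)%E ->
  `|\sum_(b < B) \sum_(j < 5) half_width s lambda (column B x b j) -
     lambda ^+ 2 * B%:R * J| <= 4 * B%:R^-1 `^ s.
Proof.
move=> B0 s12 /andP[l0 l1] /andP[x0 x1] JE; rewrite /half_width.
have Bs := powR_ge0 (B%:R^-1 : R) s.
have b0 : 0 < B%:R :> R by rewrite ltr0n.
have b1 : 1 <= B%:R :> R by rewrite ler1n.
have [->|lN0] := eqVneq lambda 0.
  rewrite big1; first by rewrite expr0n /= !mul0r subrr normr0 mulr_ge0.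
  by move=> b _; rewrite big1// => j _; rewrite mul0r.
have {}l0 : 0 < lambda by rewrite lt_neqAle eq_sym lN0.
(* Division by lambda turns the columns into nodes of mesh h for the undilated
   body. *)
pose h := (B%:R * lambda)^-1.
have h0 : 0 < h by rewrite invr_gt0 mulr_gt0.
have hbl : h * (B%:R * lambda) = 1 by rewrite mulVf// gt_eqF// mulr_gt0.
pose x' := (- 2 - x) / lambda.
have xl : x' * lambda = - 2 - x by rewrite divfK.
have hl : h * lambda <= 1 by nra.
have xh : x' + h <= -1.
  by rewrite -(ler_pM2r l0) mulrDl xl; lra.
have xK : 1 <= x' + (5 * B)%:R * h.
  rewrite -(ler_pM2r l0) mulrDl xl natrM.
  have -> : 5%:R * B%:R * h * lambda = 5 * (h * (B%:R * lambda)) by ring.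
  by rewrite hbl; lra.
have := profile_riemann_sum s12 JE h0 xh xK.
have -> : \sum_(i < 5 * B) profile s (x' + i%:R * h) =
    \sum_(b < B) \sum_(j < 5) profile s (column B x b j / lambda).
  rewrite -(sum_block _ _ (fun n => profile s (x' + n%:R * h))) exchange_big.
  apply: eq_bigr => b _; apply: eq_bigr => j _; congr profile.
  rewrite /x' /h /column natrD natrM; field.
  by rewrite !gt_eqF.
under [X in _ -> `|X - _| <= _]eq_bigr do rewrite -mulr_sumr.
rewrite -mulr_sumr; set S := \sum_(_ < _) _ => H.
have -> : lambda * S - lambda ^+ 2 * B%:R * J = lambda ^+ 2 * B%:R * (h * S - J).
  rewrite mulrBr; congr (_ - _).
  have -> : lambda ^+ 2 * B%:R * (h * S) = lambda * (h * (B%:R * lambda)) * S by ring.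
  by rewrite hbl mulr1.
have lb : 0 < lambda ^+ 2 * B%:R by rewrite mulr_gt0// exprn_gt0.
rewrite normrM (gtr0_norm lb).
apply: (le_trans (ler_wpM2l (ltW lb) H)).
have -> : lambda ^+ 2 * B%:R * (4 * (h * h `^ s)) =
   4 * (lambda * (h * (B%:R * lambda)) * h `^ s) by ring.
rewrite hbl mulr1 ler_pM2l// /h invfM powRM ?invr_ge0 ?(ltW l0) ?(ltW b0)//.
rewrite mulrCA ler_piMr//.
have : lambda^-1 `^ s <= lambda^-1.
  by apply: ler1_powR; [rewrite invf_ge1|lra].
move=> /(ler_wpM2l (ltW l0)) /le_trans; apply.
by rewrite mulfV.
Qed.

(** The Riemann sum error is O(A * B ^ (- s)), which is O(B ^ (1/2)) by the choice
    of A, and the second moment of the column errors is O(B). *)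
Lemma discrepancy_average (R : realType) (s lambda J : R) (A B : nat)
    (t : R * R) : (0 < A)%N -> (0 < B)%N -> 1 / 2 <= s <= 1 ->
  A%:R <= 2 * B%:R `^ (s + 1 / 2) -> 0 <= lambda <= 1 -> torus R t ->
  (\int[lebesgue_measure]_x (profile s x)%:E = J%:E)%E ->
  (\sum_(xi : {ffun 'I_B -> 'I_B})
     `|card_translate (shifted_grid R A xi) (dilate lambda (lame s)) t -
       (lambda ^+ 2 * (A * B)%:R)%:E * (2 * J)%:E| ^+ 2 <=
   (#|{ffun 'I_B -> 'I_B}|%:R * (612 * B%:R))%:E)%E.
Proof.
move=> A0 B0 s12 AB l01 tt JE; have /andP[l0 l1] := l01.
have b0 : 0 < B%:R :> R by rewrite ltr0n.
have b1 : 1 <= B%:R :> R by rewrite ler1n.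
have [t1 t2] := tt; move: t1 t2; rewrite /= !in_itv /= => t1 t2.
pose w (b : 'I_B) (j : nat) : R := half_width s lambda (column B t.1 b j).
have w01 b j : 0 <= w b j <= 1 by exact: half_width_bounds.
(* The square is at most twice the sum of the squares of the two errors: e is
   the counting error inside the columns, E the error of the Riemann sum. *)
pose e (b r : 'I_B) : R := \sum_(j < 5) (`|column B t.1 b j| <= lambda)%R%:R *
  (column_count A B (w b j) t.2 r - 2 * A%:R * w b j).
pose E : R := 2 * A%:R * (\sum_(b < B) \sum_(j < 5) w b j - lambda ^+ 2 * B%:R * J).
have DE (xi : {ffun 'I_B -> 'I_B}) :
  (card_translate (shifted_grid R A xi) (dilate lambda (lame s)) t -
       (lambda ^+ 2 * (A * B)%:R)%:E * (2 * J)%:E =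
   ((\sum_b e b (xi b)) + E)%:E)%E.
  rewrite card_translate_grid// -EFinM -EFinB; congr EFin.
  rewrite /E mulrBr addrA; congr (_ - _); last by rewrite natrM; ring.
  rewrite mulr_sumr -big_split /=; apply: eq_bigr => b _.
  rewrite mulr_sumr -big_split /=; apply: eq_bigr => j _; rewrite -/(w b j).
  have [_|lx] := leP; first by rewrite !mul1r subrK.
  by rewrite !mul0r add0r /w half_width_out ?mulr0.
have b01 (b : bool) (x : R) : `|x| <= 1 -> `|b%:R * x| <= 1.
  by case: b => x1; rewrite ?mul1r ?mul0r ?normr0.
have sum5 (F : 'I_5 -> R) : (forall j, `|F j| <= 1) -> `|\sum_j F j| <= 5.
  move=> F1; apply: (le_trans (ler_norm_sum _ _ _)).
  have -> : 5 = \sum_(j < 5) 1 :> R by rewrite sumr_const card_ord.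
  by apply: ler_sum.
have e5 b r : `|e b r| <= 5.
  by apply: sum5 => j; apply: b01; exact: column_count_bound.
have se5 b : `|\sum_r e b r| <= 5.
  rewrite /e exchange_big /=; apply: sum5 => j; rewrite -mulr_sumr.
  by apply: b01; exact: column_count_average.
have E2 : E ^+ 2 <= 256 * B%:R.
  have := column_area_error B0 s12 l01 t1 JE; rewrite -/(w _ _).
  set S := (\sum_(b < B) _ - _) => HS.
  have aS : `|E| <= 16 * B%:R `^ (1 / 2).
    have -> : E = 2 * A%:R * S by [].
    rewrite normrM ger0_norm ?mulr_ge0//.
    apply: (le_trans (ler_wpM2l _ HS)); first by rewrite mulr_ge0.
    have -> : 2 * A%:R * (4 * B%:R^-1 `^ s) = 8 * (A%:R * B%:R^-1 `^ s) by ring.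
    have -> : 16 * B%:R `^ (1 / 2) = 8 * (2 * B%:R `^ (1 / 2)) :> R by ring.
    rewrite ler_pM2l//.
    apply: (le_trans (ler_wpM2r (powR_ge0 _ _) AB)).
    rewrite powRD; last by apply/implyP => _; rewrite gt_eqF.
    have BB : B%:R `^ s * B%:R^-1 `^ s = 1 :> R.
      by rewrite -powRM ?invr_ge0 ?(ltW b0)// mulfV ?gt_eqF// powR1.
    by rewrite -mulrA mulrAC BB [1 * (_ `^ _)]mul1r.
  rewrite -(real_normK (num_real E)).
  have -> : 256 * B%:R = (16 * B%:R `^ (1 / 2)) ^+ 2 :> R.
    rewrite exprMn -[X in _ = _ * X]powR_mulrn ?powR_ge0// -powRrM.
    have -> : 1 / 2 * 2%:R = 1 :> R by field.
    by rewrite powRr1 ?(ltW b0)//; ring.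
  by rewrite lerXn2r ?nnegrE ?mulr_ge0 ?powR_ge0.
under eq_bigr do rewrite DE abse_EFin -EFinM -expr2 (real_normK (num_real _)).
rewrite sumEFin lee_fin.
set N := #|_|%:R.
apply: (@le_trans _ _ (\sum_(xi : {ffun 'I_B -> 'I_B})
   (2 * (\sum_b e b (xi b)) ^+ 2 + 512 * B%:R))).
  apply: ler_sum => xi _; set X := \sum_b _.
  by have := sqr_ge0 (X - E); rewrite sqrrB sqrrD; lra.
have := second_moment_shifts B0 e5 se5; rewrite -/N mulfV ?gt_eqF// => H2.
rewrite big_split /= -mulr_sumr sumr_const -mulr_natl -/N.
have N0 : 0 <= N by rewrite ler0n.
have : N * (5 ^+ 2 * B%:R + 5 ^+ 2 * 1 ^+ 2) <= N * (50 * B%:R).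
  by rewrite ler_wpM2l//; lra.
lra.
Qed.

(** The bound of discrepancy_average holds at each lambda and t, so it passes to
    the average over the shifts of the integrals. *)
Lemma good_shifts (R : realType) (s J : R) (A B : nat) :
  (0 < A)%N -> (0 < B)%N -> 1 / 2 <= s <= 1 ->
  A%:R <= 2 * B%:R `^ (s + 1 / 2) ->
  (\int[lebesgue_measure]_x (profile s x)%:E = J%:E)%E ->
  exists xi : {ffun 'I_B -> 'I_B},
  (\int[lebesgue_measure]_(lambda in `[0%R, 1%R])
     \int[lebesgue_measure \x lebesgue_measure]_(t in torus R)
       `|card_translate (shifted_grid R A xi) (dilate lambda (lame s)) t -
         (lambda ^+ 2 * (A * B)%:R)%:E * (2 * J)%:E| ^+ 2 <=
   (613 * B%:R)%:E)%E.
Proof.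
move=> A0 B0 s12 AB JE; apply: contrapT => /forallNP no.
pose f (xi : {ffun 'I_B -> 'I_B}) (lambda : R) (t : R * R) : \bar R :=
  (`|card_translate (shifted_grid R A xi) (dilate lambda (lame s)) t -
         (lambda ^+ 2 * (A * B)%:R)%:E * (2 * J)%:E| ^+ 2)%E.
have f0 xi lambda t : (0 <= f xi lambda t)%E by rewrite expe_ge0.
set N : R := #|{ffun 'I_B -> 'I_B}|%:R.
have N0 : 0 < N.
  by rewrite ltr0n card_ffun !card_ord expn_gt0 B0.
have b0 : 0 < B%:R :> R by rewrite ltr0n.
have mT : measurable (torus R).
  by apply: measurableX; exact: measurable_itv.
have muT : ((lebesgue_measure \x lebesgue_measure) (torus R) = 1 :> \bar R)%E.
  have e : lebesgue_measure (`[0, 1[%classic : set R) = 1%E.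
    by rewrite lebesgue_measure_itv /= lte_fin ltr01 sube0.
  rewrite /torus product_measure1E; [|exact: measurable_itv|exact: measurable_itv].
  exact: (etrans (congr2 mule e e) (mule1 _)).
have up : (\sum_(xi : {ffun 'I_B -> 'I_B})
    \int[lebesgue_measure]_(lambda in `[0%R, 1%R])
     \int[lebesgue_measure \x lebesgue_measure]_(t in torus R) f xi lambda t <=
   (N * (612 * B%:R))%:E)%E.
  apply: (le_trans (ge0_lower_integral_sum _ _ _)).
    by move=> xi lambda _; apply: integral_ge0 => t _; exact: f0.
  apply: (@le_trans _ _ (\int[lebesgue_measure]_(lambda in `[0%R, 1%R])
     (N * (612 * B%:R))%:E)%E).
    apply: ge0_le_lower_integral.
      by move=> lambda _; apply: sume_ge0 => xi _; apply: integral_ge0 => t _.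
    move=> lambda /=; rewrite in_itv /= => l01.
    apply: (le_trans (ge0_lower_integral_sum _ _ _)) => //.
    apply: (@le_trans _ _ (\int[lebesgue_measure \x lebesgue_measure]_(t in torus R)
     (N * (612 * B%:R))%:E)%E).
      apply: ge0_le_lower_integral; first by move=> t _; apply: sume_ge0.
      by move=> t tt; exact: discrepancy_average.
    rewrite integral_cst// [X in (_ * X)%E](_ : _ = 1%E); last exact: muT.
    by rewrite mule1.
  rewrite integral_cst//= lebesgue_measure_itv /= lte_fin ltr01.
  by rewrite sube0 mule1.
(* If every choice exceeded 613 * B, so would the average, which is at most
   612 * B. *)
have : ((N * (613 * B%:R))%:E <= (N * (612 * B%:R))%:E)%E.
  apply: le_trans up.
  have -> : (N * (613 * B%:R))%:E = (\sum_(xi : {ffun 'I_B -> 'I_B}) (613 * B%:R)%:E)%E.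
    by rewrite sumEFin sumr_const /N mulr_natl.
  by apply: lee_sum => xi _; rewrite ltW// ltNge; apply/negP/no.
by rewrite lee_fin ler_pM2l// ler_pM2r// ler_nat.
Qed.

(** Rounding B ^ (s + 1/2) up to an integer A loses at most a factor 2, and then
    A * B >= B ^ (s + 3/2) converts the bound O(B) into a power of the number of
    points. *)
Lemma low_discrepancy_sets (R : realType) (s : R) (B : nat) :
  (0 < B)%N -> 1 / 2 <= s <= 1 ->
  exists P : {fset R * R}, [/\ [set` P] `<=` torus R, (B <= #|` P|)%N &
  (\int[lebesgue_measure]_(lambda in `[0%R, 1%R])
     \int[lebesgue_measure \x lebesgue_measure]_(t in torus R)
       `|card_translate P (dilate lambda (lame s)) t -
         (lambda ^+ 2 * #|` P|%:R)%:E * area (lame s)| ^+ 2 <=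
   (613 * #|` P|%:R `^ (2 / (2 * s + 3)))%:E)%E].
Proof.
move=> B0 s12; have [J JE areaE] := lame_area s12.
pose p : R := B%:R `^ (s + 1 / 2).
have b0 : 0 < B%:R :> R by rewrite ltr0n.
have p1 : 1 <= p.
  by rewrite -[X in X <= _](powRr0 B%:R) /p ler_powR ?ler1n//; lra.
have [A [A0 AU AL]] : exists A : nat, [/\ (0 < A)%N, A%:R <= 2 * p & p <= A%:R].
  exists (Num.truncn p).+1; split => //; last by rewrite ltW// truncnS_gt.
  have : (Num.truncn p)%:R <= p by rewrite truncn_le//; lra.
  by rewrite -natr1; lra.
have [xi xiP] := good_shifts A0 B0 s12 AU JE.
have cardE : #|` shifted_grid R A xi| = (A * B)%N by rewrite card_shifted_grid.
exists (shifted_grid R A xi); split.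
- exact: shifted_grid_torus.
- by rewrite cardE leq_pmull.
rewrite cardE areaE; apply: (le_trans xiP); rewrite lee_fin ler_pM2l ?ltr0n//.
have bpow : B%:R `^ (s + 3 / 2) <= (A * B)%:R :> R.
  have -> : s + 3 / 2 = s + 1 / 2 + 1 by field.
  rewrite powRD; last by apply/implyP => _; rewrite gt_eqF.
  by rewrite powRr1 ?(ltW b0)// natrM ler_pM2r.
have -> : (B%:R : R) = (B%:R `^ (s + 3 / 2)) `^ (2 / (2 * s + 3)).
  rewrite -powRrM (_ : _ * _ = 1) ?powRr1 ?(ltW b0)//.
  by field; apply/eqP; lra.
apply: ge0_ler_powR => //.
- by rewrite divr_ge0//; lra.
- by rewrite nnegrE powR_ge0.
- by rewrite nnegrE ler0n.
Qed.

Theorem theorem8 (R : realType) (sigma : R)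
  (hsigma : 1 / 2 <= sigma <= 1) :
  exists (c : R) (C : set (R * R)) (P : nat -> {fset R * R}),
    [/\ 0 < c,
        planar_convex_body C,
        forall j, [set` P j] `<=` torus R,
        (fun j => #|` P j|) @ \oo --> \oo &
        (exists (delta0 c1 c2 : R) (I : set R),
          [/\ [/\ 0 < delta0, 0 < c1 & 0 < c2],
              [/\ is_interval I, I `<=` `]- pi, pi[ &
                  (0 < lebesgue_measure I)%E] &
              forall delta : R, 0 < delta <= delta0 ->
                (forall theta, I theta ->
                   ((c1 * delta `^ (1 / 2))%:E <=
                    chord_length C (- dir theta)%R delta +
                    chord_length C (dir theta) delta)%E) /\
                (forall theta, (`]- pi, pi[ `\` I) theta ->
                   ((c2 * delta `^ sigma)%:E <=
                    chord_length C (- dir theta)%R delta +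
                    chord_length C (dir theta) delta)%E)]) /\
        (forall j,
          (\int[lebesgue_measure]_(lambda in `[0%R, 1%R])
             \int[lebesgue_measure \x lebesgue_measure]_(t in torus R)
               `| card_translate (P j) (dilate lambda C) t -
                  (lambda ^+ 2 * #|` P j|%:R)%:E * area C | ^+ 2
           <= (c * #|` P j|%:R `^ (2 / (2 * sigma + 3)))%:E)%E)].
Proof.
have [P hP] := choice (fun j => low_discrepancy_sets (ltn0Sn j) hsigma).
exists 613, (lame sigma), P; split.
- by rewrite ltr0n.
- exact: lame_convex_body.
- by move=> j; have [] := hP j.
- apply/cvgnyPge => n; near=> j; have [_ + _] := hP j; apply: leq_trans.
  by near: j; exists n => // j /= nj; exact: ltnW.
- split; first exact: lame_chords.
  by move=> j; have [] := hP j.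
Unshelve. all: by end_near. Qed.
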